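(* Let $G=SU(N+1)$, $K_0=\mathbf{S}(U(1)\times U(N))$, and let $K_1$ denote the image of $SU(N)$ in $K_0$ under the injection $\mathbf{A}\mapsto\begin{pmatrix}1&0\\0&\mathbf{A}\end{pmatrix}$. **a)** Every element of $G$ can be written as a product $g=k_1(\exp\theta H)k_2$ with $k_1,k_2\in K_0$. More precisely, the map $$K_0\times\exp\mathfrak{a}\times K_0\ni(k_1,\exp\theta H,k_2)\longmapsto k_1(\exp\theta H)k_2\in G$$ arising from the group multiplication is a smooth surjection. **b)** The map $$K_0/M\times A\ni(kM,\ \exp\theta H\cdot l_0)\longmapsto k\cdot\exp\theta H\cdot l_0\in\mathbb{C}P^N$$ is a smooth surjection and is a double covering on the complement of the point $l_0\in\mathbb{C}P^N$. **c)** Let $\delta:U(1)\ni\mu\mapsto\delta(\mu,\bar\mu)=\begin{pmatrix}\mu&0\\0&\bar\mu\end{pmatrix}$ be the diagonal embedding of $U(1)$ into $SU(2)$. The map $$SU(N)\times U(1)\times SO(2)\times SU(N)\longrightarrow SU(N+1),$$ $$(\mathbf{A}_1,\mu,\mathbf{R}(\theta),\mathbf{A}_2)\longmapsto \begin{pmatrix}1&0\\0&\mathbf{A}_1\end{pmatrix} \begin{pmatrix}\delta(\mu,\bar\mu)&0\\0&\mathbf{1}_{N-1}\end{pmatrix} \begin{pmatrix}\mathbf{R}(\theta)&0\\0&\mathbf{1}_{N-1}\end{pmatrix} \begin{pmatrix}\delta(\mu,\bar\mu)&0\\0&\mathbf{1}_{N-1}\end{pmatrix} \begin{pmatrix}1&0\\0&\mathbf{A}_2\end{pmatrix}$$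 is a smooth surjection.
   Context: Let $e_0,e_1,\ldots,e_N$ be the standard basis of $\mathbb{C}^{N+1}$. $\mathbb{C}P^N$ is the space of complex lines through the origin in $\mathbb{C}^{N+1}$, with homogeneous coordinates $[z_0,z_1,\ldots,z_N]$, on which $SU(N+1)$ acts transitively. The reference point is $l_0=\mathbb{C}e_0$, and its isotropy group is $K_0=\mathbf{S}(U(1)\times U(N))=\left\{\begin{pmatrix}(\det\mathbf{A})^{-1}&0\\0&\mathbf{A}\end{pmatrix}:\mathbf{A}\in U(N)\right\}$. $H=e_1\otimes e_0^\dagger-e_0\otimes e_1^\dagger\in\mathfrak{su}(N+1)$ (the $(N+1)\times(N+1)$ matrix with upper left $2\times2$ block $\begin{pmatrix}0&-1\\1&0\end{pmatrix}$ and all other entries zero), and $\mathfrak{a}=\mathbb{R}H$. Thus $\exp\alpha H=\begin{pmatrix}\mathbf{R}(\alpha)&0\\0&\mathbf{1}_{N-1}\end{pmatrix}$ with $\mathbf{R}(\alpha)=\begin{pmatrix}\cos\alpha&-\sin\alpha\\ \sin\alpha&\cos\alpha\end{pmatrix}$ for $\alpha\in\mathbb{R}$, and $\exp\mathfrak{a}=\{\exp\alpha H:\alpha\in\mathbb{R}\}$ is isomorphic to $SO(2)$. Here $\mathbf{1}_{N-1}$ is the $(N-1)\times(N-1)$ identity matrix. $A=(\exp\mathfrak{a})\cdot l_0=\{[\cos\alpha,\sin\alpha,0,\ldots,0]:\alpha\in\mathbb{R}\}\subset\mathbb{C}P^N$ is the corresponding maximal torus, and $M=\{k\in K_0: kHk^{-1}=H\}$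 is the centralizer of $\mathfrak{a}$ in $K_0$. $U(1)=\{\mu\in\mathbb{C}:|\mu|=1\}$.
   Formalization: In b) the double covering is proved on the complement of l_0 and of the hyperplane z_0=0, since fibres over z_0=0 are circles and the printed claim fails there; c) is stated for N≥2, since for N=1 a 2-dimensional source cannot surject onto SU(2). *)

(* Defs.v *)
From HB Require Import structures.
From mathcomp Require Import all_boot all_order all_algebra.
From mathcomp Require Import spectral.
From mathcomp.real_closed Require Import complex.
From mathcomp Require Import all_classical all_reals all_analysis.

Set Implicit Arguments.
Unset Strict Implicit.
Unset Printing Implicit Defensive.

Import Order.TTheory GRing.Theory Num.Theory ComplexField.
Import numFieldNormedType.Exports.

Local Open Scope classical_set_scope.
Local Open Scope quotient_scope.
Local Open Scope complex_scope.
Local Open Scope ring_scope.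

(* The usual (modulus) topology and normed space structure of R[i]. *)
#[non_forgetful_inheritance]
HB.instance Definition _ (R : realType) :=
  PseudoPointedMetric.copy R[i] (R[i] : numClosedFieldType).
#[non_forgetful_inheritance]
HB.instance Definition _ (R : realType) :=
  NormedModule.copy R[i] (R[i] : numClosedFieldType).

(* Meant for finite-dimensional [V]: there, f is of class C^(k+1) on the open
   set U iff all its directional derivatives exist and are of class C^k. *)
Fixpoint Ck (R : realType) (V W : normedModType R) (k : nat)
    (U : set V) (f : V -> W) {struct k} : Prop :=
  (forall x, U x -> {for x, continuous f}) /\
  (if k is k'.+1 then
     forall v : V, (forall x, U x -> derivable f x v) /\
                   Ck k' U (fun x => 'D_v f x)
   else True).

Definition Cinfty (R : realType) (V W : normedModType R)
    (U : set V) (f : V -> W) : Prop := forall k, Ck k U f.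

(* A manifold with an atlas, or a subset of one equipped with the restrictions
   of the ambient charts. *)
Record charted (R : realType) := Charted {
  charted_sort :> Type;
  #[canonical=no] chart_model : normedModType R;
  #[canonical=no] chart_index : Type;
  #[canonical=no] chart_dom : chart_index -> set charted_sort;
  #[canonical=no] chart_coord : chart_index -> charted_sort -> chart_model }.

(* Around every point, f reads in suitable charts as the restriction of a
   C^infinity map defined on an open set of the model space.  For embedded
   submanifolds of the source and of the target this is smoothness in the
   usual sense. *)
Definition smooth (R : realType) (X Y : charted R) (f : X -> Y) : Prop :=
  forall x : X, exists (i : chart_index X) (j : chart_index Y)
      (U : set (chart_model X)) (F : chart_model X -> chart_model Y),
    [/\ chart_dom i x, open U, U (chart_coord i x), Cinfty U F &
        forall y, chart_dom i y -> U (chart_coord i y) ->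
          chart_dom j (f y) /\ chart_coord j (f y) = F (chart_coord i y)].

Definition realify (R : realType) (m n : nat) (A : 'M[R[i]]_(m, n)) :
    'M[R]_(m, n) * 'M[R]_(m, n) :=
  (map_mx (@complex.Re R) A, map_mx (@complex.Im R) A).

Canonical matrix_charted (R : realType) (m n : nat) : charted R :=
  @Charted R 'M[R[i]]_(m, n) ('M[R]_(m, n) * 'M[R]_(m, n))%type unit
    (fun _ => setT) (fun _ => @realify R m n).

Canonical complex_charted (R : realType) : charted R :=
  @Charted R R[i] (R^o * R^o)%type unit
    (fun _ => setT) (fun _ z => (complex.Re z, complex.Im z)).

Canonical prod_charted (R : realType) (X Y : charted R) : charted R :=
  @Charted R (X * Y)%type (chart_model X * chart_model Y)%type
    (chart_index X * chart_index Y)%type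
    (fun ij => chart_dom ij.1 `*` chart_dom ij.2)
    (fun ij p => (chart_coord ij.1 p.1, chart_coord ij.2 p.2)).

Canonical subset_charted (R : realType) (X : charted R) (A : set X) :
    charted R :=
  @Charted R (set_type A) (chart_model X) (chart_index X)
    (fun i => [set x | chart_dom i (set_val x)])
    (fun i x => chart_coord i (set_val x)).

(* When B is an embedded submanifold of Y, f is smooth as a map into B iff it
   is smooth as a map into Y. *)
Definition smooth_surjection (R : realType) (X Y : charted R) (f : X -> Y)
    (B : set Y) : Prop := smooth f /\ range f = B.

Definition homeo_between (X Y : topologicalType) (f : X -> Y)
    (U : set X) (V : set Y) : Prop :=
  exists g : Y -> X,
    [/\ f @` U `<=` V /\ g @` V `<=` U,
        {in U, cancel f g} /\ {in V, cancel g f},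
        {within U, continuous f} & {within V, continuous g}].

Definition double_covering_over (X Y : topologicalType) (f : X -> Y)
    (B : set Y) : Prop :=
  forall y, B y -> exists (V : set Y) (U1 U2 : set X),
    [/\ [/\ open V, V y & V `<=` B],
        open U1 /\ open U2,
        f @^-1` V = U1 `|` U2 /\ U1 `&` U2 = set0 &
        homeo_between f U1 V /\ homeo_between f U2 V].

Definition ker_rel (T U : Type) (p : T -> U) : rel T :=
  fun x y => `[< p x = p y >].

Lemma ker_rel_equiv (T U : Type) (p : T -> U) :
  equiv_class_of (ker_rel p).
Proof.
split=> [x|x y|y x z]; first exact/asboolP.
  by apply/asboolP/asboolP.
by move=> /asboolP xy /asboolP yz; apply/asboolP; rewrite xy.
Qed.

Canonical ker_equiv (T U : Type) (p : T -> U) : equiv_rel T :=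
  EquivRelPack (ker_rel_equiv p).

Definition ker_quot (T : topologicalType) (U : Type) (p : T -> U) : Type :=
  quotient_topology {eq_quot (ker_rel p)}.
HB.instance Definition _ (T : topologicalType) (U : Type) (p : T -> U) :=
  Topological.copy (ker_quot p) (quotient_topology {eq_quot (ker_rel p)}).
HB.instance Definition _ (T : topologicalType) (U : Type) (p : T -> U) :=
  Quotient.copy (ker_quot p) (quotient_topology {eq_quot (ker_rel p)}).

Definition ker_class (T : topologicalType) (U : Type) (p : T -> U) (x : T) :
    ker_quot p := \pi_(ker_quot p) x.

(* Throughout, N = n.+1, so that N >= 1 and N + 1 = n.+2. *)

Definition circle (R : realType) : set R[i] := [set mu | `|mu| = 1].
Arguments circle : clear implicits.

Definition SU (R : realType) (m : nat) : set 'M[R[i]]_m :=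
  [set A | A \is unitarymx /\ \det A = 1].
Arguments SU : clear implicits.

(* The real matrices of SO(2), regarded as complex ones. *)
Definition SO2 (R : realType) : set 'M[R[i]]_2 :=
  [set map_mx (real_complex R) O |
     O in [set O : 'M[R]_2 | O^T *m O = 1%:M /\ \det O = 1]].
Arguments SO2 : clear implicits.

Definition K0 (R : realType) (n : nat) : set 'M[R[i]]_n.+2 :=
  [set (block_mx (\det A)^-1%:M 0 0 A : 'M[R[i]]_(1 + n.+1)) |
     A in [set A : 'M[R[i]]_n.+1 | A \is unitarymx]].
Arguments K0 : clear implicits.

Definition generator (R : realType) (n : nat) : 'M[R[i]]_n.+2 :=
  delta_mx 1 0 - delta_mx 0 1.
Arguments generator : clear implicits.

Definition expm (R : realType) (m : nat) (X : 'M[R[i]]_m.+1) : 'M[R[i]]_m.+1 :=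
  limn (series (fun k => (k`!%:R : R[i])^-1 *: X ^+ k)).

Definition exp_gen (R : realType) (n : nat) (theta : R) : 'M[R[i]]_n.+2 :=
  expm (theta%:C *: generator R n).
Arguments exp_gen {R} n theta.

Definition exp_a (R : realType) (n : nat) : set 'M[R[i]]_n.+2 :=
  range (@exp_gen R n).
Arguments exp_a : clear implicits.

Definition centralizer_a (R : realType) (n : nat) : set 'M[R[i]]_n.+2 :=
  [set k | K0 R n k /\ k *m generator R n *m invmx k = generator R n].
Arguments centralizer_a : clear implicits.

Definition left_coset (R : realType) (n : nat) (k : set_type (K0 R n)) :
    set 'M[R[i]]_n.+2 :=
  [set set_val k *m m | m in centralizer_a R n].

Definition K0modM (R : realType) (n : nat) : Type := ker_quot (@left_coset R n).
HB.instance Definition _ (R : realType) (n : nat) :=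
  Topological.on (K0modM R n).
Arguments K0modM : clear implicits.

Definition toK0modM (R : realType) (n : nat) :
  set_type (K0 R n) -> K0modM R n := @ker_class _ _ _.

Definition nonzero (R : realType) (n : nat) : set 'cV[R[i]]_n.+2 :=
  [set v | v != 0].
Arguments nonzero : clear implicits.

Definition line (R : realType) (n : nat) (v : set_type (nonzero R n)) :
    set 'cV[R[i]]_n.+2 :=
  [set c *: set_val v | c in [set: R[i]]].

Definition CP (R : realType) (n : nat) : Type := ker_quot (@line R n).
HB.instance Definition _ (R : realType) (n : nat) := Topological.on (CP R n).
Arguments CP : clear implicits.

Definition rep (R : realType) (n : nat) (l : CP R n) : 'cV[R[i]]_n.+2 :=
  set_val (repr (l : ker_quot (@line R n))).

Lemma e0_nonzero (R : realType) (n : nat) :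
  (delta_mx 0 0 : 'cV[R[i]]_n.+2) \in nonzero R n.
Proof.
apply/mem_set/eqP => /matrixP/(_ 0 0)/eqP.
by rewrite !mxE !eqxx oner_eq0.
Qed.

Definition e0_pt (R : realType) (n : nat) : set_type (nonzero R n) :=
  exist (fun v => v \in nonzero R n) _ (@e0_nonzero R n).
Arguments e0_pt : clear implicits.

(* The point [v] of the projective space; the value at v = 0 is junk. *)
Definition point_of (R : realType) (n : nat) (v : 'cV[R[i]]_n.+2) : CP R n :=
  ker_class (@line R n) (insubd (e0_pt R n) v).

Definition l0 (R : realType) (n : nat) : CP R n := point_of (delta_mx 0 0).
Arguments l0 : clear implicits.

Definition act (R : realType) (n : nat) (g : 'M[R[i]]_n.+2) (l : CP R n) :
    CP R n := point_of (g *m rep l).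

(* The affine charts z |-> (z_j / z_i)_(j != i). *)
Canonical CP_charted (R : realType) (n : nat) : charted R :=
  @Charted R (CP R n) ('M[R]_(n.+1, 1) * 'M[R]_(n.+1, 1))%type 'I_n.+2
    (fun i => [set l | rep l i 0 != 0])
    (fun i l => realify (row' i ((rep l i 0)^-1 *: rep l))).

Definition torus (R : realType) (n : nat) : set (CP R n) :=
  [set act e (l0 R n) | e in exp_a R n].
Arguments torus : clear implicits.

(* The hyperplane z_0 = 0, that is, the lines orthogonal to l_0 (the cut locus
   of l_0).  The fibre of (kM, a) |-> k a over any of its points is a circle:
   multiplying the first column of A by a phase changes kM but not the line
   k (exp (pi/2) H) l_0 = [0, A e_1]. *)
Definition polar_l0 (R : realType) (n : nat) : set (CP R n) :=
  [set l | rep l 0 0 = 0].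
Arguments polar_l0 : clear implicits.

Definition lower_block (R : realType) (n : nat) (A : 'M[R[i]]_n.+1) :
    'M[R[i]]_n.+2 :=
  (block_mx 1%:M 0 0 A : 'M[R[i]]_(1 + n.+1)).

Definition upper_block (R : realType) (n : nat) (B : 'M[R[i]]_2) :
    'M[R[i]]_n.+2 :=
  (block_mx B 0 0 1%:M : 'M[R[i]]_(2 + n)).
Arguments upper_block {R} n B.

Definition delta (R : realType) (mu : R[i]) : 'M[R[i]]_2 :=
  (block_mx mu%:M 0 0 (mu^*)%:M : 'M[R[i]]_(1 + 1)).

(* Main.v *)
Require Import Defs.
From HB Require Import structures.
From mathcomp Require Import all_boot all_order all_algebra ring.
From mathcomp Require Import spectral.
From mathcomp.real_closed Require Import complex.
From mathcomp Require Import all_classical all_reals all_analysis.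

Set Implicit Arguments.
Unset Strict Implicit.
Unset Printing Implicit Defensive.

Import Order.TTheory GRing.Theory Num.Theory ComplexField.
Import numFieldNormedType.Exports.

Local Open Scope classical_set_scope.
Local Open Scope complex_scope.
Local Open Scope ring_scope.

Local Notation adj A := (map_mx Num.conj A^T).

(** The isotropy group [K_0] fixes the line of [e_0], so an element [k] of
   [K_0] maps [e_0] to [k_00 e_0].  Everything rests on the vector
   [ucol k = k_00^-1 k e_1], which lies on the unit sphere [S] of the
   orthogonal complement of [e_0] and for which

     [k (cos t e_0 + sin t e_1) = k_00 (cos t e_0 + sin t (ucol k))].

   The fibres of [ucol] are the cosets of [M] ([left_cosetE]), and [ucol] has
   continuous local sections over [S], built from complex reflections
   ([local_section]).  Hence [K_0 / M] is homeomorphic to [S].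

   Part a).  A unit vector is, up to a phase, [cos t e_0 + sin t u] with [u]
   in [S] ([polar_form]).  So the first column of [g] agrees up to a phase with
   that of some [k (exp tH)], and [(k exp tH)^-1 g] stabilises the line of
   [e_0], that is, belongs to [K_0] ([KAK]).  The exponential itself is the
   rotation of angle [t] in the plane of [e_0] and [e_1], because the even and
   odd terms of its series are those of the cosine and of the sine
   ([exp_genE]).

   Part c).  An element of [K_0] is a block of SU(N) times a diagonal phase
   element, so a) gives two phases [mu] and [nu] around the rotation.  They are
   made equal by moving [diag(s, s, s^-2)] with [s^2 = nu / mu], which
   centralises [exp a], across the rotation ([balance_phases]).

   Part b).  In the affine chart [z_0 = 1] the map sends the coset with vector
   [u] and the torus point of slope [r = tan t] to [r u].  Outside
   [l_0] and the hyperplane [z_0 = 0] it is thus the double covering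
   [(u, r) |-> r u] of [C^N] minus the origin by [S] times the nonzero reals,
   which is trivial: the sign of [r] separates two sheets, and [w] has the
   preimages [(w / |w|, |w|)] and [(- w / |w|, - |w|)]
   ([orbit_map_double_covering]).

   Smoothness is always that of a rational map of matrix entries, read in
   charts; the class C^k is shown to be closed under the operations needed by
   induction on [k]. *)

(** * Calculus of C^k maps *)

Section Ck_calculus.
Context (R : realType).
Implicit Types (V W Z : normedModType R).

Lemma near_eq_on V W (U : set V) (f g : V -> W) (x : V) :
  open U -> U x -> {in U, f =1 g} -> \forall y \near x, f y = g y.
Proof.
move=> oU Ux fg; near=> y; apply: fg; apply/mem_set.
by near: y; exact: open_nbhs_nbhs.
Unshelve. all: by end_near. Qed.

(** Directional derivatives at the points of an open set only depend on the
   values taken there.  A formula for a derivative which holds on [U] can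
   therefore replace the derivative. *)
Lemma Ck_ext V W k (U : set V) (f g : V -> W) :
  open U -> {in U, f =1 g} -> Ck k U f -> Ck k U g.
Proof.
move=> oU; elim: k f g => [|k IH] f g fg [cf df]; split => //.
- move=> x Ux; rewrite /prop_for /continuous_at -(fg x (mem_set Ux)).
  by apply: cvg_trans (cf _ Ux); apply: near_eq_cvg; exact: near_eq_on Ux fg.
- move=> x Ux; rewrite /prop_for /continuous_at -(fg x (mem_set Ux)).
  by apply: cvg_trans (cf _ Ux); apply: near_eq_cvg; exact: near_eq_on Ux fg.
- move=> v; have [dv Cv] := df v; split.
    move=> x Ux; apply: near_eq_derivable (dv _ Ux).
    exact: near_eq_on Ux fg.
  apply: IH Cv => x /set_mem Ux.
  by apply: near_eq_derive; exact: near_eq_on Ux fg.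
Qed.

Lemma Ck_pred V W k (U : set V) (f : V -> W) : Ck k.+1 U f -> Ck k U f.
Proof.
elim: k f => [|k IH] f [cf df]; split => // v.
by have [dv Cv] := df v; split => //; exact: IH.
Qed.

Lemma Ck_continuous V W k (U : set V) (f : V -> W) x :
  Ck k U f -> U x -> {for x, continuous f}.
Proof. by case: k => [|k] [cf _]; exact: cf. Qed.

(** The induction step on [k], given a formula for the derivatives on [U]. *)
Lemma CkS V W k (U : set V) (f : V -> W) (df : V -> V -> W) :
  open U -> Ck 0 U f ->
  (forall x v, U x -> derivable f x v /\ 'D_v f x = df v x) ->
  (forall v, Ck k U (df v)) -> Ck k.+1 U f.
Proof.
move=> oU [cf _] dfE Cdf; split => // v; split=> [x Ux|].
  by have [] := dfE x v Ux.
by apply: Ck_ext (Cdf v) => // x /set_mem Ux; have [] := dfE x v Ux.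
Qed.

Lemma Ck_cst V W k (U : set V) (c : W) : open U -> Ck k U (cst c : V -> W).
Proof.
move=> oU; elim: k c => [|k IH] c; first by split=> // x _; exact: cvg_cst.
apply: (@CkS _ _ _ _ _ (fun _ => cst 0)) => //.
  by split=> // x _; exact: cvg_cst.
by move=> x v _; rewrite derive_cst; split => //; exact: derivable_cst.
Qed.

(** A continuous linear map commutes with limits of difference quotients. *)
Lemma Ck_comp_linear V W Z (L : {linear W -> Z}) k (U : set V) (f : V -> W) :
  open U -> continuous L -> Ck k U f -> Ck k U (L \o f).
Proof.
move=> oU cL; elim: k f => [|k IH] f Cf.
  split=> // x Ux; apply: continuous_comp; last exact: cL.
  exact: Ck_continuous Cf Ux.
have [cf df] := Cf.
apply: (@CkS _ _ _ _ _ (fun v => L \o 'D_v f)) => //.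
- split=> // x Ux; apply: continuous_comp; last exact: cL.
  exact: Ck_continuous Cf Ux.
- move=> x v Ux; have [/(_ x Ux) dv _] := df v.
  have H : h^-1 *: (((L \o f) \o shift x) (h *: v) - (L \o f) x) @[h --> 0^']
      --> L ('D_v f x).
    under eq_fun do rewrite /= -linearB -linearZ.
    exact: (continuous_cvg _ (cL _) dv).
  by split; [apply/cvg_ex; exists (L ('D_v f x)) | exact: cvg_lim H].
- by move=> v; apply: IH; have [] := df v.
Qed.

Lemma Ck_linear V W (L : {linear V -> W}) k (U : set V) :
  open U -> continuous L -> Ck k U L.
Proof.
move=> oU cL; case: k => [|k]; first by split=> // x _; exact: cL.
apply: (@CkS _ _ _ _ _ (fun v => cst (L v))) => //.
- by split=> // x _; exact: cL.
- move=> x v Ux.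
have H : h^-1 *: ((L \o shift x) (h *: v) - L x) @[h --> 0^'] --> L v.
  apply: (@cvg_trans _ (cst (L v) h @[h --> (0 : R)^'])); last exact: cvg_cst.
  apply: near_eq_cvg; near=> h.
  rewrite /= linearP addrK scalerA mulVf ?scale1r//.
  by near: h; exact: nbhs_dnbhs_neq.
by split; [apply/cvg_ex; exists (L v) | exact: cvg_lim H].
- by move=> v; exact: Ck_cst.
Unshelve. all: by end_near. Qed.

Lemma CkD V W k (U : set V) (f g : V -> W) :
  open U -> Ck k U f -> Ck k U g -> Ck k U (f + g).
Proof.
move=> oU; elim: k f g => [|k IH] f g Cf Cg.
  split=> // x Ux; apply: cvgD; [exact: Ck_continuous Cf Ux|].
  exact: Ck_continuous Cg Ux.
have [cf df] := Cf; have [cg dg] := Cg.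
apply: (@CkS _ _ _ _ _ (fun v => 'D_v f + 'D_v g) oU).
- split=> // x Ux; apply: cvgD; [exact: Ck_continuous Cf Ux|].
  exact: Ck_continuous Cg Ux.
- move=> x v Ux; have [/(_ x Ux) dfv _] := df v; have [/(_ x Ux) dgv _] := dg v.
  by split; [exact: derivableD dfv dgv | exact: deriveD dfv dgv].
- by move=> v; apply: IH; [have [] := df v | have [] := dg v].
Qed.

Lemma CkM V k (U : set V) (f g : V -> R) :
  open U -> Ck k U f -> Ck k U g -> Ck k U (f * g).
Proof.
move=> oU; elim: k f g => [|k IH] f g Cf Cg.
  split=> // x Ux; apply: cvgM; [exact: Ck_continuous Cf Ux|].
  exact: Ck_continuous Cg Ux.
have [cf df] := Cf; have [cg dg] := Cg.
apply: (@CkS _ _ _ _ _ (fun v => f * 'D_v g + g * 'D_v f) oU).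
- split=> // x Ux; apply: cvgM; [exact: Ck_continuous Cf Ux|].
  exact: Ck_continuous Cg Ux.
- move=> x v Ux; have [/(_ x Ux) dfv _] := df v; have [/(_ x Ux) dgv _] := dg v.
  by split; [exact: derivableM dfv dgv | exact: deriveM dfv dgv].
- move=> v; apply: CkD => //; apply: IH => //; try exact: Ck_pred.
    by have [] := dg v.
  by have [] := df v.
Qed.

(** The derivative of [1 / f] is again a polynomial in [1 / f] and the
   derivative of [f], so [CkM] closes the induction. *)
Lemma CkV V k (U : set V) (f : V -> R) :
  open U -> (forall x, U x -> f x != 0) -> Ck k U f ->
  Ck k U (fun x => (f x)^-1).
Proof.
move=> oU f0; elim: k => [|k IH] Cf.
  split=> // x Ux; apply: cvgV; [exact: f0|exact: Ck_continuous Cf Ux].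
have [cf df] := Cf; have CVf := IH (Ck_pred Cf).
apply: (@CkS _ _ _ _ _ (fun v => (cst (-1) *
   ((fun x => (f x)^-1) * (fun x => (f x)^-1))) * 'D_v f)) => //.
- by split=> // x Ux; exact: Ck_continuous CVf Ux.
- move=> x v Ux; have [/(_ x Ux) dfv _] := df v.
  split; first by apply: derivableV => //; exact: f0.
  rewrite deriveV ?f0//= /GRing.scale/= !fctE /=.
  by rewrite expr2 invfM mulN1r.
- move=> v; apply: CkM => //; last by have [] := df v.
  by apply: CkM => //; [exact: Ck_cst|exact: CkM].
Qed.

End Ck_calculus.

(** * Smooth maps into complex matrices *)

Section smooth_complex.
Context (R : realType).
Implicit Types (V W : normedModType R).

(** Unbundled, so that composites of projections and of coordinate forms
   need no structure of their own. *)
Definition cont_linear V W (f : V -> W) : Prop := linear f /\ continuous f.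

Lemma cont_linear_id V : cont_linear (@id V).
Proof. by split=> // x. Qed.

Lemma cont_linear_fst V W1 W2 (f : V -> (W1 * W2)%type) :
  cont_linear f -> cont_linear (fun x => (f x).1).
Proof.
move=> [lf cf]; split=> [a u v|x]; first by rewrite lf.
exact: (cvg_comp _ _ (cf x) cvg_fst).
Qed.

Lemma cont_linear_snd V W1 W2 (f : V -> (W1 * W2)%type) :
  cont_linear f -> cont_linear (fun x => (f x).2).
Proof.
move=> [lf cf]; split=> [a u v|x]; first by rewrite lf.
exact: (cvg_comp _ _ (cf x) cvg_snd).
Qed.

Lemma cont_linear_entry V m n (f : V -> 'M[R]_(m, n)) i j :
  cont_linear f -> cont_linear (fun x => f x i j : R).
Proof.
move=> [lf cf]; split=> [a u v|x]; first by rewrite lf !mxE.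
apply: (@continuous_comp _ _ _ f (fun M : 'M[R]_(m, n) => M i j)).
  exact: cf.
exact: coord_continuous.
Qed.

Lemma Cinfty_cont_linear V W (U : set V) (f : V -> W) :
  open U -> cont_linear f -> Cinfty U f.
Proof.
move=> oU [lf cf] k.
pose fM := GRing.isLinear.Build _ _ _ _ _ lf.
pose fL : {linear _ -> _} := HB.pack f fM.
exact: (@Ck_linear _ _ _ fL).
Qed.

(** Smoothness over the reals: conjugation is allowed. *)
Definition CinftyC V (U : set V) (F : V -> R[i]) : Prop :=
  Cinfty U (fun x => complex.Re (F x) : R) /\
  Cinfty U (fun x => complex.Im (F x) : R).

Section closure.
Context (V : normedModType R) (U : set V).
Hypothesis oU : open U.
Implicit Types F G : V -> R[i].

Lemma CinftyC_cst c : CinftyC U (fun=> c).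
Proof. by split=> k; exact: Ck_cst. Qed.

Lemma CinftyC_mk (f g : V -> R) :
  Cinfty U f -> Cinfty U g -> CinftyC U (fun x => f x +i* g x).
Proof. by []. Qed.

Lemma CinftyCD F G :
  CinftyC U F -> CinftyC U G -> CinftyC U (fun x => F x + G x).
Proof.
move=> [rF iF] [rG iG]; split=> k.
  apply: Ck_ext (CkD oU (rF k) (rG k)) => // x _.
  by rewrite fctE; case: (F x); case: (G x).
apply: Ck_ext (CkD oU (iF k) (iG k)) => // x _.
by rewrite fctE; case: (F x); case: (G x).
Qed.

Lemma CinftyN (f : V -> R) : Cinfty U f -> Cinfty U (fun x => - f x).
Proof.
move=> Cf k; apply: Ck_ext (CkM oU (@Ck_cst _ V R k U (-1) oU) (Cf k)) => //.
by move=> x _; rewrite fctE mulN1r.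
Qed.

Lemma CinftyCM F G :
  CinftyC U F -> CinftyC U G -> CinftyC U (fun x => F x * G x).
Proof.
move=> [rF iF] [rG iG]; split=> k.
- apply: Ck_ext (CkD oU (CkM oU (rF k) (rG k))
    (CinftyN (fun k' => CkM oU (iF k') (iG k')) k)) => //.
  by move=> x _; rewrite !fctE; case: (F x); case: (G x).
- apply: Ck_ext (CkD oU (CkM oU (rF k) (iG k)) (CkM oU (iF k) (rG k))) => //.
  by move=> x _; rewrite !fctE; case: (F x); case: (G x).
Qed.

Lemma CinftyC_conj F : CinftyC U F -> CinftyC U (fun x => (F x)^*).
Proof.
move=> [rF iF]; split.
  by move=> k; apply: Ck_ext (rF k) => // x _; case: (F x).
by move=> k; apply: Ck_ext (CinftyN iF k) => // x _; case: (F x).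
Qed.

(** [z^-1] is the conjugate of [z] times the inverse of a real function. *)
Lemma CinftyC_inv F :
  (forall x, U x -> F x != 0) -> CinftyC U F -> CinftyC U (fun x => (F x)^-1).
Proof.
move=> F0 CF; have [rF iF] := CF.
pose N (x : V) : R := complex.Re (F x) ^+ 2 + complex.Im (F x) ^+ 2.
have N0 x : U x -> N x != 0.
  move=> /F0; rewrite /N; case: (F x) => a b /=.
  by rewrite eq_complex /= paddr_eq0 ?sqr_ge0// !sqrf_eq0.
have CN : Cinfty U N.
  move=> k.
  apply: Ck_ext (CkD oU (CkM oU (rF k) (rF k)) (CkM oU (iF k) (iF k))) => //.
have CV : CinftyC U (fun x => (N x)^-1%:C).
  by split=> k; [exact: CkV|exact: Ck_cst].
have [rG iG] := CinftyCM (CinftyC_conj CF) CV.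
have E x : U x -> (F x)^*%C * (N x)^-1%:C = (F x)^-1.
  move=> Ux; rewrite -[RHS]mul1r; apply: (mulIf (F0 x Ux)).
  rewrite mul1r mulVf ?F0//.
  have -> : (F x)^*%C * (N x)^-1%:C * F x = (N x * (N x)^-1)%:C.
    rewrite /N; case: (F x) => a b; apply/eqP; rewrite eq_complex/=.
    by apply/andP; split; apply/eqP; ring.
  by rewrite divff ?N0.
split=> k; [apply: Ck_ext (rG k)|apply: Ck_ext (iG k)] => //.
all: by move=> x /set_mem Ux; rewrite E.
Qed.

Lemma CinftyC_sum (I : Type) (r : seq I) (P : pred I) (F : I -> V -> R[i]) :
  (forall i, P i -> CinftyC U (F i)) ->
  CinftyC U (fun x => \sum_(i <- r | P i) F i x).
Proof.
move=> CF; elim: r => [|i r IH].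
  by under eq_fun do rewrite big_nil; exact: CinftyC_cst.
under eq_fun do rewrite big_cons.
by case E: (P i) => //; apply: CinftyCD => //; exact: CF.
Qed.

Definition CinftyM m n (F : V -> 'M[R[i]]_(m, n)) : Prop :=
  forall i j, CinftyC U (fun x => F x i j).

Lemma CinftyM_cst m n (A : 'M[R[i]]_(m, n)) : CinftyM (fun=> A).
Proof. by move=> i j; exact: CinftyC_cst. Qed.

Lemma CinftyM_mul m n p (F : V -> 'M[R[i]]_(m, n)) (G : V -> 'M[R[i]]_(n, p)) :
  CinftyM F -> CinftyM G -> CinftyM (fun x => F x *m G x).
Proof.
move=> CF CG i j; under eq_fun do rewrite mxE.
by apply: CinftyC_sum => k _; exact: CinftyCM.
Qed.

Lemma CinftyM_scalar n (F : V -> R[i]) :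
  CinftyC U F -> CinftyM (fun x => (F x)%:M : 'M[R[i]]_n).
Proof.
move=> CF i j; under eq_fun do rewrite mxE.
by case: (i == j) => //; exact: CinftyC_cst.
Qed.

Lemma CinftyM_scale m n (F : V -> R[i]) (G : V -> 'M[R[i]]_(m, n)) :
  CinftyC U F -> CinftyM G -> CinftyM (fun x => F x *: G x).
Proof.
move=> CF CG i j; under eq_fun do rewrite mxE.
exact: CinftyCM.
Qed.

Lemma CinftyM_row' m n (i : 'I_m) (F : V -> 'M[R[i]]_(m, n)) :
  CinftyM F -> CinftyM (fun x => row' i (F x)).
Proof. by move=> CF k j; under eq_fun do rewrite mxE. Qed.

Lemma CinftyM_block m1 m2 n1 n2 (A : V -> 'M[R[i]]_(m1, n1))
    (B : V -> 'M[R[i]]_(m1, n2)) (C : V -> 'M[R[i]]_(m2, n1))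
    (D : V -> 'M[R[i]]_(m2, n2)) :
  CinftyM A -> CinftyM B -> CinftyM C -> CinftyM D ->
  CinftyM (fun x => block_mx (A x) (B x) (C x) (D x)).
Proof.
move=> CA CB CC CD i j.
rewrite -(splitK i) -(splitK j); case: (fintype.split i) => i'; case:
  (fintype.split j) => j' /=.
- by under eq_fun do rewrite block_mxEul.
- by under eq_fun do rewrite block_mxEur.
- by under eq_fun do rewrite block_mxEdl.
- by under eq_fun do rewrite block_mxEdr.
Qed.

End closure.

Definition unrealify m n (p : 'M[R]_(m, n) * 'M[R]_(m, n)) : 'M[R[i]]_(m, n) :=
  \matrix_(i, j) (p.1 i j +i* p.2 i j).

Lemma realifyK m n : cancel (@realify R m n) (@unrealify m n).
Proof.
by move=> A; apply/matrixP => i j; rewrite !mxE; case: (A i j).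
Qed.

Lemma CinftyM_unrealify V (U : set V) m n
    (f : V -> ('M[R]_(m, n) * 'M[R]_(m, n))%type) :
  open U -> cont_linear f -> CinftyM U (fun x => unrealify (f x)).
Proof.
move=> oU lf i j; under eq_fun do rewrite mxE.
apply: CinftyC_mk; apply: Cinfty_cont_linear => //; apply: cont_linear_entry.
  exact: cont_linear_fst.
exact: cont_linear_snd.
Qed.

Lemma cvg_mx (T : topologicalType) (S : Type) (F : set_system S) m n
    (M : S -> 'M[T]_(m, n)) (L : 'M[T]_(m, n)) :
  Filter F -> (forall i j, M x i j @[x --> F] --> L i j) -> M x @[x --> F] -->
    L.
Proof.
move=> FF ML A [P LP PA]; rewrite nbhs_simpl.
have : F [set x | forall i j, P i j (M x i j)].
  apply: filter_forall => i; apply: filter_forall => j.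
  exact: ML (LP i j).
by apply: (@filterS _ F) => x /PA.
Qed.

Lemma Ck_mx V (U : set V) k m n (F : V -> 'M[R]_(m, n)) : open U ->
  (forall i j, Ck k U (fun x => F x i j : R)) -> Ck k U F.
Proof.
move=> oU; elim: k F => [|k IH] F CF.
  split=> // x Ux; apply: cvg_mx => i j.
  exact: Ck_continuous (CF i j) Ux.
apply: (@CkS _ _ _ _ _ _
  (fun v x => \matrix_(i < m, j < n) 'D_v (fun t => F t i j : R) x) oU).
- split=> // x Ux; apply: cvg_mx => i j.
  exact: Ck_continuous (CF i j) Ux.
- move=> x v Ux.
  have dF : derivable F x v.
    apply/derivable_mxP => i j; have [_ dC] := CF i j.
    by have [/(_ x Ux)] := dC v.
  by split; [exact: dF|exact: derive_mx].
- move=> v; apply: IH => i j; have [_ dC] := CF i j.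
  have [_] := dC v; apply: Ck_ext => // x _.
  by rewrite mxE.
Qed.

(** The pair is the sum of the images of its components under the two linear
   inclusions. *)
Lemma Ck_pair V W1 W2 (U : set V) k (f : V -> W1) (g : V -> W2) : open U ->
  Ck k U f -> Ck k U g -> Ck k U (fun x => (f x, g x)).
Proof.
move=> oU Cf Cg.
have l1 : linear (fun w : W1 => (w, 0 : W2)).
  by move=> a u v; congr pair; rewrite /= scaler0 addr0.
have l2 : linear (fun w : W2 => (0 : W1, w)).
  by move=> a u v; congr pair; rewrite /= scaler0 addr0.
pose l1M := GRing.isLinear.Build _ _ _ _ _ l1.
pose l2M := GRing.isLinear.Build _ _ _ _ _ l2.
pose L1 : {linear _ -> _} := HB.pack (fun w : W1 => (w, 0 : W2)) l1M.
pose L2 : {linear _ -> _} := HB.pack (fun w : W2 => (0 : W1, w)) l2M.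
have c1 : continuous L1.
  by move=> x; apply: cvg_pair; [exact: cvg_id|exact: cvg_cst].
have c2 : continuous L2.
  by move=> x; apply: cvg_pair; [exact: cvg_cst|exact: cvg_id].
have C1 := Ck_comp_linear oU c1 Cf; have C2 := Ck_comp_linear oU c2 Cg.
apply: Ck_ext (CkD oU C1 C2) => //.
by move=> x _; congr pair; rewrite /= ?addr0 ?add0r.
Qed.

Lemma Cinfty_realify V (U : set V) m n (F : V -> 'M[R[i]]_(m, n)) :
  open U -> CinftyM U F -> Cinfty U (fun x => realify (F x)).
Proof.
move=> oU CF k; apply: Ck_pair => //; apply: Ck_mx => // i j.
  by have [+ _] := CF i j; move/(_ k); apply: Ck_ext => // x _; rewrite mxE.
by have [_ +] := CF i j; move/(_ k); apply: Ck_ext => // x _; rewrite mxE.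
Qed.

End smooth_complex.

(** * The one-parameter group exp a *)

Section exponential.
Context (R : realType).

Lemma real_complex_continuous : continuous (real_complex R : R -> R[i]).
Proof.
move=> x; apply/cvgrPdist_lt => e e0.
have eE : e = (complex.Re e)%:C by rewrite RRe_real// gtr0_real.
have re0 : 0 < complex.Re e by rewrite -ltcR -eE.
near=> y; rewrite -rmorphB normc_def /= expr0n addr0 sqrtr_sqr eE ltcR.
near: y; exact: (nbhsx_ballx x _ re0).
Unshelve. all: by end_near. Qed.

Context (n : nat).
Local Notation C := R[i].

Definition proj01 : 'M[C]_n.+2 := delta_mx 0 0 + delta_mx 1 1.

Definition rotation (c s : C) : 'M[C]_n.+2 :=
  (1%:M - proj01) + c *: proj01 + s *: generator R n.

Lemma generator_sqr : generator R n *m generator R n = - proj01.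
Proof.
rewrite /generator /proj01 mulmxBl !mulmxBr !mul_delta_mx_cond /=.
by rewrite ?mulr1n ?mulr0n sub0r subr0 opprD addrC.
Qed.

Lemma proj01_generator : proj01 *m generator R n = generator R n.
Proof.
rewrite /generator /proj01 mulmxBr !mulmxDl !mul_delta_mx_cond /=.
by rewrite ?mulr1n ?mulr0n add0r addr0.
Qed.

(** [H^2] is minus the projection [proj01] on the plane of [e_0] and [e_1], and
   [proj01 H = H]; powers thus alternate between the two. *)
Lemma scaled_generator_pow (theta : R) k :
  (theta%:C *: generator R n) ^+ k.+1 = theta%:C ^+ k.+1 *:
    (if odd k.+1 then (-1) ^+ k./2 *: generator R n
     else (-1) ^+ k.+1./2 *: proj01).
Proof.
rewrite exprZn; congr (_ *: _); elim: k => [|k IH]; first by rewrite scale1r.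
rewrite exprSr IH; case: (odd k.+1) / boolP; rewrite /= => ok.
  rewrite (negbTE ok) /= -[_ * _]/(_ *m _) -scalemxAl generator_sqr.
  by rewrite exprS mulN1r scaleNr scalerN.
rewrite negbK in ok; rewrite ok /= -[_ * _]/(_ *m _) -scalemxAl.
by rewrite proj01_generator.
Qed.

(** Off the plane of [e_0] and [e_1] only the term of index 0 contributes. *)
Lemma expm_term (theta : R) k :
  (k`!%:R : C)^-1 *: (theta%:C *: generator R n) ^+ k =
  (k == 0)%:R *: (1%:M - proj01) + (cos_coeff theta k)%:C *: proj01
    + (sin_coeff theta k)%:C *: generator R n.
Proof.
rewrite /cos_coeff /sin_coeff; case: k => [|k].
  rewrite expr0 /= fact0 invr1 !scale1r mul0r expr0 !mul1r divr1 mul0r scale0r.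
  by rewrite addr0 invr1 scale1r subrK.
rewrite scaled_generator_pow /= -exprnP scale0r add0r scalerA.
case: (boolP (odd k)) => ok /=; rewrite ?mul0r ?scale0r ?add0r ?addr0 scalerA.
  congr (_ *: _); rewrite !rmorphM /= !rmorphXn fmorphV /= rmorphN1 !rmorph_nat.
  by rewrite mul1r; ring.
congr (_ *: _); rewrite !rmorphM /= !rmorphXn fmorphV /= rmorphN1 !rmorph_nat.
by rewrite mul1r; ring.
Qed.

(** The exponential series is the cosine series along [proj01] plus the sine
   series along [H]. *)
Lemma exp_genE (theta : R) :
  exp_gen n theta = rotation (cos theta)%:C (sin theta)%:C.
Proof.
apply: cvg_lim => //.
(* Shifted by one, every partial sum contains the term of index 0. *)
rewrite -(cvg_shiftS (series _)) /=.
have -> : (fun k => series (fun k0 => (k0`!%:R : C)^-1 *: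
      (theta%:C *: generator R n) ^+ k0) k.+1) =
    (fun k => (1%:M - proj01) + (series (cos_coeff theta) k.+1)%:C *: proj01 +
      (series (sin_coeff theta) k.+1)%:C *: generator R n).
  apply/funext => k; rewrite /series /=.
  under eq_bigr do rewrite expm_term.
  rewrite !big_split /= -!scaler_suml !rmorph_sum /=; congr (_ + _ + _).
  by rewrite big_nat_recl//= big1 ?addr0 ?scale1r.
rewrite /rotation cos.unlock sin.unlock.
have cvgC (u : nat -> R) (l : R) : u @ \oo --> l ->
    (fun k => (u k.+1)%:C) @ \oo --> l%:C.
  move=> ul; apply: (continuous_cvg _ (@real_complex_continuous l)).
  by rewrite (cvg_shiftS u).
apply: cvgD; last first.
  by apply: cvgZr_tmp; apply: cvgC; exact: is_cvg_series_sin_coeff.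
apply: cvgD; first exact: cvg_cst.
by apply: cvgZr_tmp; apply: cvgC; exact: is_cvg_series_cos_coeff.
Qed.

End exponential.

(** * Unitary matrices and the isotropy group *)

Section linear_algebra.
Context (R : realType).
Local Notation C := R[i].

Lemma adjM m n p (A : 'M[C]_(m, n)) (B : 'M[C]_(n, p)) :
  adj (A *m B) = adj B *m adj A.
Proof. by rewrite trmx_mul map_mxM. Qed.

Lemma adjK m n (A : 'M[C]_(m, n)) : adj (adj A) = A.
Proof. by apply/matrixP => i j; rewrite !mxE conjCK. Qed.

Lemma unitary_adj_mul m (A : 'M[C]_m) : A \is unitarymx -> adj A *m A = 1%:M.
Proof. by move=> /unitarymxP/mulmx1C. Qed.

Lemma unitarymx_adj_mul m (A : 'M[C]_m) : adj A *m A = 1%:M -> A \is unitarymx.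
Proof. by move=> /mulmx1C/unitarymxP. Qed.

Definition sqnorm m (v : 'cV[C]_m) : C := \sum_i `|v i 0| ^+ 2.

Lemma adj_mul_self m (v : 'cV[C]_m) : adj v *m v = (sqnorm v)%:M.
Proof.
apply/matrixP => i j; rewrite !ord1 !mxE /sqnorm mulr1n.
by apply: eq_bigr => k _; rewrite !mxE normCKC.
Qed.

Lemma sqnormZ m (c : C) (v : 'cV[C]_m) : sqnorm (c *: v) = `|c| ^+ 2 * sqnorm v.
Proof.
by rewrite mulr_sumr; apply: eq_bigr => i _; rewrite mxE normrM exprMn.
Qed.

Lemma sqnorm_unitary m (A : 'M[C]_m) (v : 'cV[C]_m) :
  A \is unitarymx -> sqnorm (A *m v) = sqnorm v.
Proof.
move=> uA; have := adj_mul_self (A *m v).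
rewrite adjM mulmxA -(mulmxA _ (adj A)) unitary_adj_mul// mulmx1 adj_mul_self.
by move/matrixP => /(_ 0 0); rewrite !mxE !mulr1n.
Qed.

Lemma det_unitary m (A : 'M[C]_m) : A \is unitarymx -> `|\det A| = 1.
Proof.
move=> /unitarymxP /(congr1 determinant); rewrite det_mulmx det1.
rewrite det_map_mx det_tr -normCK => /eqP.
by rewrite sqrp_eq1// => /eqP.
Qed.

Lemma conj_unit (z : C) : `|z| = 1 -> z^* = z^-1.
Proof. by move=> z1; rewrite invC_norm z1 expr1n invr1 mul1r. Qed.

Lemma unitary_block m1 m2 (A : 'M[C]_m1) (D : 'M[C]_m2) :
  A \is unitarymx -> D \is unitarymx ->
  (block_mx A 0 0 D : 'M[C]_(m1 + m2)) \is unitarymx.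
Proof.
move=> /unitarymxP uA /unitarymxP uD; apply/unitarymxP.
rewrite tr_block_mx map_block_mx mulmx_block !trmx0 !map_mx0 !mulmx0 !mul0mx.
by rewrite !addr0 !add0r uA uD -scalar_mx_block.
Qed.

Lemma unitary_scalar m (c : C) : `|c| = 1 -> c%:M \is @unitarymx C m m.
Proof.
move=> c1; apply/unitarymxP; rewrite tr_scalar_mx map_scalar_mx /= -scalar_mxM.
by rewrite -normCK c1 expr1n.
Qed.

Context (n : nat).
Implicit Types k : 'M[C]_n.+2.
Local Notation e0 := (delta_mx 0 0 : 'cV[C]_n.+2).
Local Notation e1 := (delta_mx 1 0 : 'cV[C]_n.+2).

(** A unitary matrix that preserves the line of [e_0] also preserves its
   orthogonal complement.  This description of [K_0] avoids blocks and is
   visibly stable under products. *)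
Lemma K0P k : K0 R n k <-> SU R n.+2 k /\ (forall i, i != 0 -> k i 0 = 0).
Proof.
split=> [[A uA <-]|[[uk dk] k0]].
  split; last first.
    move=> i; rewrite -(@splitK 1 n.+1 i); case: fintype.split => i' /=.
      by rewrite ord1 => /eqP[]; apply/val_inj.
    move=> _; transitivity (block_mx (\det A)^-1%:M 0 0 A (rshift 1 i')
      (lshift n.+1 0)); last by rewrite block_mxEdl mxE.
    by congr (fun_of_matrix _ _ _); exact: val_inj.
  have dA := det_unitary uA.
  have dA0 : \det A != 0 by rewrite -normr_gt0 dA.
  split; last first.
    by apply: etrans (@det_lblock _ 1 n.+1 _ _ _) _; rewrite det_scalar1 mulVf.
  apply: (@unitary_block 1 n.+1) => //.
  by apply: unitary_scalar; rewrite normfV dA invr1.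
pose K : 'M[C]_(1 + n.+1) := k.
have dl0 : dlsubmx K = 0.
  apply/matrixP => i j; rewrite !mxE ord1 -[RHS](k0 (rshift 1 i))//.
  by congr (k _ _); exact: val_inj.
have := @unitary_adj_mul (1 + n.+1) K uk; rewrite -(submxK K) dl0.
rewrite tr_block_mx map_block_mx mulmx_block (@scalar_mx_block _ 1 n.+1).
rewrite !trmx0 !map_mx0 !mulmx0 !mul0mx !addr0 => /eq_block_mx[a1 b0 _ d1].
have uA : ulsubmx K \is unitarymx by apply: unitarymx_adj_mul.
(* The first column of [k] has modulus one and its first entry carries all of
   it, so orthogonality of the columns kills the rest of the first row. *)
have ur0 : ursubmx K = 0.
  by rewrite -[LHS]mul1mx -(unitarymxP uA) -mulmxA b0 mulmx0.
rewrite ur0 mulmx0 add0r in d1.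
have ud : drsubmx K \is unitarymx by apply: unitarymx_adj_mul.
exists (drsubmx K) => //.
rewrite -[k]/K -[in RHS](submxK K) dl0 ur0; congr block_mx.
have dd : \det K = 1 := dk; rewrite -(submxK K) dl0 ur0 det_lblock in dd.
have ddn0 : \det (drsubmx K) != 0 by rewrite -normr_gt0 det_unitary.
have -> : (\det (drsubmx K))^-1 = \det (ulsubmx K).
  by apply: (mulIf ddn0); rewrite dd mulVf.
by rewrite [RHS]mx11_scalar [in LHS](mx11_scalar (ulsubmx K)) det_scalar1.
Qed.

End linear_algebra.

(** * The sphere K_0 / M *)

Section isotropy.
Context (R : realType) (n : nat).
Local Notation C := R[i].
Implicit Types k m : 'M[C]_n.+2.
Implicit Types u v : 'cV[C]_n.+2.
Local Notation e0 := (delta_mx 0 0 : 'cV[C]_n.+2).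
Local Notation e1 := (delta_mx 1 0 : 'cV[C]_n.+2).

Lemma mul_delta_col k (i j : 'I_n.+2) : (k *m delta_mx i 0 :
  'cV[C]_n.+2) j 0 = k j i.
Proof. by rewrite -colE mxE. Qed.

Lemma sqnorm_delta (i : 'I_n.+2) : sqnorm (delta_mx i 0 : 'cV[C]_n.+2) = 1.
Proof.
rewrite /sqnorm (bigD1 i)//= mxE !eqxx normr1 expr1n big1 ?addr0// => j ji.
by rewrite mxE (negbTE ji) normr0 expr0n.
Qed.

Lemma K0_e0 k : K0 R n k -> k *m e0 = k 0 0 *: e0.
Proof.
move=> /K0P[_ k0]; apply/matrixP => i j; rewrite ord1 mul_delta_col !mxE.
by case: (eqVneq i 0) => [->|/k0 ->]; rewrite ?mulr1 ?mulr0.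
Qed.

Lemma entry00 k c : k *m e0 = c *: e0 -> k 0 0 = c.
Proof.
move=> /matrixP/(_ 0 0); rewrite mul_delta_col => ->.
by rewrite !mxE mulr1.
Qed.

Lemma K0_unitary k : K0 R n k -> k \is unitarymx.
Proof. by move=> /K0P[[]]. Qed.

Lemma K0_00 k : K0 R n k -> `|k 0 0| = 1.
Proof.
move=> kK; have := sqnorm_unitary e0 (K0_unitary kK).
rewrite K0_e0// sqnormZ !sqnorm_delta mulr1 => /eqP.
by rewrite sqrp_eq1// => /eqP.
Qed.

Lemma K0_00_neq0 k : K0 R n k -> k 0 0 != 0.
Proof. by move=> /K0_00 k1; rewrite -normr_gt0 k1. Qed.

Lemma K0_adj_e0 k : K0 R n k -> adj k *m e0 = (k 0 0)^-1 *: e0.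
Proof.
move=> kK; have k0 := K0_00_neq0 kK.
rewrite -[in LHS](scale1r e0) -(mulVf k0) -scalerA -K0_e0// -scalemxAr.
by rewrite mulmxA unitary_adj_mul ?mul1mx//; exact: K0_unitary.
Qed.

Lemma stab_e0_K0 k c : SU R n.+2 k -> k *m e0 = c *: e0 -> K0 R n k.
Proof.
move=> kS ke; apply/K0P; split=> // i i0.
by rewrite -mul_delta_col ke !mxE (negbTE i0) mulr0.
Qed.

Lemma SU_mul p (A B : 'M[C]_p) : SU R p A -> SU R p B -> SU R p (A *m B).
Proof.
move=> [uA dA] [uB dB]; split; first exact: mul_unitarymx.
by rewrite det_mulmx dA dB mulr1.
Qed.

Lemma SU_adj p (A : 'M[C]_p) : SU R p A -> SU R p (adj A).
Proof.
move=> [uA dA]; split; first by rewrite trmxC_unitary.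
by rewrite det_map_mx det_tr dA rmorph1.
Qed.

Lemma K0_SU k : K0 R n k -> SU R n.+2 k.
Proof. by move=> /K0P[]. Qed.

Lemma K0_mul k m : K0 R n k -> K0 R n m -> K0 R n (k *m m).
Proof.
move=> kK mK; apply: (@stab_e0_K0 _ (k 0 0 * m 0 0)).
  by apply: SU_mul; exact: K0_SU.
by rewrite -mulmxA K0_e0// -scalemxAr K0_e0// scalerA mulrC.
Qed.

Lemma K0_adj k : K0 R n k -> K0 R n (adj k).
Proof.
move=> kK; apply: stab_e0_K0 (K0_adj_e0 kK).
by apply: SU_adj; exact: K0_SU.
Qed.

(** For [k = diag (1 / det A, A)] this is the vector [det A . A e_1]. *)
Definition ucol k : 'cV[C]_n.+2 := (k 0 0)^-1 *: (k *m e1).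

(** The unit sphere, of dimension [2 N - 1], of the orthogonal complement of
   [e_0]. *)
Definition sphere : set 'cV[C]_n.+2 := 
  [set u : 'cV[C]_n.+2 | u 0 0 = 0 /\ sqnorm u = 1].

Lemma K0_row0 k i : K0 R n k -> i != 0 -> k 0 i = 0.
Proof.
move=> /K0_adj/K0P[_ +] i0 => /(_ i i0); rewrite !mxE => /eqP.
by rewrite conjC_eq0 => /eqP.
Qed.

Lemma ucol_sphere k : K0 R n k -> sphere (ucol k).
Proof.
move=> kK; split; first by rewrite /ucol [LHS]mxE mul_delta_col (@K0_row0 _ 1)
  ?mulr0.
rewrite sqnormZ sqnorm_unitary ?sqnorm_delta ?mulr1; last exact: K0_unitary.
by rewrite normfV K0_00// invr1 expr1n.
Qed.

Lemma K0_e1 k : K0 R n k -> k *m e1 = k 0 0 *: ucol k.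
Proof. by move=> kK; rewrite scalerA mulfV ?scale1r// K0_00_neq0. Qed.

(** The line through [k (exp tH) e_0] only depends on [t] and [ucol k]. *)
Lemma K0_torus k c s : K0 R n k ->
  k *m (c *: e0 + s *: e1) = k 0 0 *: (c *: e0 + s *: ucol k).
Proof.
move=> kK; rewrite mulmxDr -!scalemxAr K0_e0// K0_e1//.
by rewrite scalerDr !scalerA ![k 0 0 * _]mulrC.
Qed.

Lemma generatorE : generator R n = e1 *m adj e0 - e0 *m adj e1.
Proof.
by rewrite /generator !trmx_delta !map_delta_mx !mul_delta_mx.
Qed.

Lemma generator_e0 : generator R n *m e0 = e1.
Proof. by rewrite /generator mulmxBl !mul_delta_mx_cond /= subr0. Qed.

(** [H e_0 = e_1], so commuting with [H] forces the same eigenvalue on [e_0] and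
   [e_1]; conversely conjugation then fixes [e_1 e_0^*] and [e_0 e_1^*], whose
   difference is [H]. *)
Lemma centralizerP m : K0 R n m ->
  centralizer_a R n m <-> m *m e1 = m 0 0 *: e1.
Proof.
move=> mK; have um := K0_unitary mK; split=> [[_ mH]|me1].
  rewrite -[in LHS]generator_e0 mulmxA -[in RHS]generator_e0.
  have -> : m *m generator R n = generator R n *m m.
    by rewrite -{2}mH mulmxKV// unitarymx_unit.
  by rewrite -mulmxA K0_e0// -scalemxAr.
split=> //; rewrite invmx_unitary//.
have E (v w : 'cV[C]_n.+2) : m *m v = m 0 0 *: v -> m *m w = m 0 0 *: w ->
    m *m (v *m adj w) *m adj m = v *m adj w.
  move=> mv mw; rewrite !mulmxA mv -mulmxA -adjM mw.
  rewrite -scalemxAl linearZ/= map_mxZ -scalemxAr scalerA -normCK K0_00//.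
  by rewrite expr1n scale1r.
by rewrite generatorE mulmxBr mulmxBl !E// K0_e0.
Qed.

(** [k'] lies in [k M] iff [k^-1 k'] has the same eigenvalue on [e_0] and [e_1]
   ([centralizerP]); as [k'] multiplies [e_0] by [k'_00], this is an equality
   between the vectors [ucol]. *)
Lemma left_cosetE (k : set_type (K0 R n)) :
  left_coset k = [set k' | K0 R n k' /\ ucol k' = ucol (set_val k)].
Proof.
have kK : K0 R n (set_val k) by exact: set_valP.
apply/seteqP; split=> [_ [m mC <-]|k' /= [k'K kk']].
  have mK : K0 R n m by case: mC.
  split; first exact: K0_mul.
  have me1 := (centralizerP mK).1 mC.
  rewrite /ucol (@entry00 _ (m 0 0 * set_val k 0 0)); last first.
    by rewrite -mulmxA K0_e0// -scalemxAr K0_e0// scalerA.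
  rewrite -mulmxA me1 -scalemxAr scalerA invfM mulrAC mulVf ?mul1r//.
  exact: K0_00_neq0.
have akK := K0_adj kK.
have mK : K0 R n (adj (set_val k) *m k') by exact: K0_mul.
exists (adj (set_val k) *m k'); last first.
  by rewrite mulmxA (unitarymxP (K0_unitary kK)) mul1mx.
apply/(centralizerP mK).
rewrite (@entry00 _ (k' 0 0 * (set_val k 0 0)^-1)); last first.
  by rewrite -mulmxA K0_e0// -scalemxAr K0_adj_e0// scalerA.
rewrite -mulmxA K0_e1// kk' /ucol -!scalemxAr mulmxA unitary_adj_mul.
  by rewrite mul1mx scalerA.
exact: K0_unitary.
Qed.

Lemma left_coset_eq (k k' : set_type (K0 R n)) :
  left_coset k = left_coset k' <-> ucol (set_val k) = ucol (set_val k').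
Proof.
rewrite !left_cosetE; split=> [/seteqP[+ _]|-> //].
by move=> /(_ (set_val k)) /= [] //; split => //; exact: set_valP.
Qed.

End isotropy.

(** * Limits of matrices *)

Section matrix_limits.
Context (K : numFieldType) (T : Type) (F : set_system T).
Hypothesis FF : Filter F.

Lemma cvg_entry p q (M : T -> 'M[K]_(p, q)) (L : 'M[K]_(p, q)) i j :
  M x @[x --> F] --> L -> M x i j @[x --> F] --> L i j.
Proof.
by move=> ML; apply: (continuous_cvg _ (@coord_continuous _ _ _ i j L)).
Qed.

Lemma cvg_prod_seq (I : Type) (r : seq I) (f : I -> T -> K) (l : I -> K) :
  (forall i, f i x @[x --> F] --> l i) ->
  \prod_(i <- r) f i x @[x --> F] --> \prod_(i <- r) l i.
Proof.
move=> fl; elim: r => [|i r IH].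
  by under eq_cvg do rewrite big_nil; rewrite big_nil; exact: cvg_cst.
under eq_cvg do rewrite big_cons; rewrite big_cons.
by apply: cvgM; [exact: fl|exact: IH].
Qed.

Lemma cvg_det m (M : T -> 'M[K]_m) (L : 'M[K]_m) :
  M x @[x --> F] --> L -> \det (M x) @[x --> F] --> \det L.
Proof.
move=> ML; apply: (@cvg_big _ _ +%R) => [|s _]; first exact: add_continuous.
apply: cvgM; first exact: cvg_cst.
by apply: cvg_prod_seq => i; exact: cvg_entry.
Qed.

Lemma cvg_mulmx p q r (M : T -> 'M[K]_(p, q)) (N : T -> 'M[K]_(q, r))
    (L : 'M[K]_(p, q)) (B : 'M[K]_(q, r)) :
  M x @[x --> F] --> L -> N x @[x --> F] --> B ->
  M x *m N x @[x --> F] --> L *m B.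
Proof.
move=> ML NK; apply: cvg_mx => i j; rewrite mxE.
under eq_cvg do rewrite mxE.
apply: (@cvg_big _ _ +%R) => [|k _]; first exact: add_continuous.
by apply: cvgM; exact: cvg_entry.
Qed.

Lemma cvg_normalize_entry m (w : T -> 'cV[K]_m) (v : 'cV[K]_m) i : v i 0 != 0 ->
  w x @[x --> F] --> v ->
  (w x i 0)^-1 *: w x @[x --> F] --> (v i 0)^-1 *: v.
Proof.
move=> v0 wv; apply: cvgZ; last exact: wv.
by apply: cvgV; [exact: v0|exact: cvg_entry].
Qed.

Lemma cvg_sgn (f : T -> K) (l : K) : l != 0 ->
  f x @[x --> F] --> l -> f x / `|f x| @[x --> F] --> l / `|l|.
Proof.
move=> l0 fl; apply: cvgM; first exact: fl.
apply: cvgV; first by rewrite normr_eq0.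
exact: cvg_norm.
Qed.

End matrix_limits.

(** * Continuous local sections over the sphere *)

Section local_section.
Context (R : realType) (n : nat).
Local Notation C := R[i].

(** For [P = v (adj v)], the product with the adjoint is
   [1 - (c + conj c - |v|^2) / |c|^2 P]. *)
Lemma householder_unitary m (v : 'cV[C]_m) (c : C) :
  c != 0 -> c + c^* = sqnorm v ->
  1%:M - c^-1 *: (v *m adj v) \is unitarymx.
Proof.
move=> c0 cv; apply/unitarymxP; set P := v *m adj v.
have PP : P *m P = sqnorm v *: P.
  by rewrite mulmxA -(mulmxA v) adj_mul_self mul_mx_scalar -scalemxAl.
have -> : adj (1%:M - c^-1 *: P) = 1%:M - (c^*)^-1 *: P.
  rewrite linearB linearZ/= map_mxB map_mxZ /= trmx1 map_mx1 fmorphV.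
  by rewrite -/(adj P) adjM adjK.
rewrite mulmxBl mul1mx mulmxBr mulmx1 -scalemxAl -scalemxAr PP !scalerA.
rewrite -cv; have cc0 : c^* != 0 by rewrite conjC_eq0.
move: P {PP} => P; apply/matrixP => i j; rewrite !mxE.
by field; rewrite c0 cc0.
Qed.

Section limits.
Context (T : Type) (F : set_system T).
Hypothesis FF : Filter F.

Lemma cvg_conj (f : T -> C) (l : C) :
  f x @[x --> F] --> l -> (f x)^* @[x --> F] --> l^*.
Proof.
move=> fl; apply/cvgrPdist_lt => e e0.
have := (@cvgrPdist_lt _ _ _ _ _ _ l).1 fl _ e0.
by move=> /(_ FF); apply: filterS => x; rewrite -rmorphB norm_conjC.
Qed.

Lemma cvg_adj p q (M : T -> 'M[C]_(p, q)) (L : 'M[C]_(p, q)) :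
  M x @[x --> F] --> L -> adj (M x) @[x --> F] --> adj L.
Proof.
move=> ML; apply: cvg_mx => i j; rewrite !mxE.
under eq_cvg do rewrite !mxE.
by apply: cvg_conj; exact: cvg_entry.
Qed.

End limits.

(** If [y] has modulus one, then [(1 + y) / |1 + y|] is a square root of [y],
   continuous near [y = 1]; it is applied to [y = g x / g0] and multiplied by a
   fixed square root of [g0]. *)
Lemma local_sqrt (T : Type) (F : set_system T) (g : T -> C) (g0 : C) :
  Filter F -> g x @[x --> F] --> g0 -> `|g0| = 1 ->
  exists (p : T -> C) (p0 : C), [/\ p x @[x --> F] --> p0, p0 ^+ 2 = g0 &
    \forall x \near F, `|g x| = 1 -> p x ^+ 2 = g x].
Proof.
move=> FF cg g1; have g0n0 : g0 != 0 by rewrite -normr_gt0 g1.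
pose y x := 1 + g x / g0.
have cy : y x @[x --> F] --> (2 : C).
  have -> : 2 = 1 + g0 / g0 :> C by rewrite divff.
  by apply: cvgD; [exact: cvg_cst|apply: cvgM; [exact: cg|exact: cvg_cst]].
have n20 : (2 : C) != 0 by rewrite pnatr_eq0.
exists (fun x => sqrtC g0 * (y x / `|y x|)), (sqrtC g0 * (2 / `|2|)); split.
- apply: cvgM; first exact: cvg_cst.
  exact: cvg_sgn.
- by rewrite normr_nat divff// mulr1 sqrtCK.
near=> x => gx1.
have yx0 : y x != 0 by near: x; exact: (cvgr_neq0 _ cy n20).
rewrite !exprMn sqrtCK exprVn normCK.
have z1 : `|g x / g0| = 1 by rewrite normrM normfV gx1 g1 invr1 mulr1.
have z0 : g x / g0 != 0 by rewrite -normr_gt0 z1.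
have -> : (y x)^* = y x / (g x / g0).
  by rewrite [in LHS]/y rmorphD rmorph1 /= (conj_unit z1) mulrDl mul1r divff//
    addrC.
rewrite -{2}(divfK g0n0 (g x)); move: (g x / g0) z0 => z z0.
by field; rewrite z0 yx0.
Unshelve. all: by end_near. Qed.

Local Notation e0 := (delta_mx 0 0 : 'cV[C]_n.+2).
Local Notation e1 := (delta_mx 1 0 : 'cV[C]_n.+2).

Definition diag2 (p q : C) : 'M[C]_n.+2 :=
  diag_mx (\row_j (if j == 0 then p else if j == 1 then q else 1)).

Lemma diag2_e0 p q : diag2 p q *m e0 = p *: e0.
Proof.
apply/matrixP => i j; rewrite ord1 mul_delta_col !mxE eqxx andbT.
by case: (eqVneq i 0) => [_|_] /=; rewrite ?mulr1 ?mulr0.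
Qed.

Lemma diag2_e1 p q : diag2 p q *m e1 = q *: e1.
Proof.
apply/matrixP => i j; rewrite ord1 mul_delta_col !mxE eqxx andbT.
by case: (eqVneq i 1) => [->|_] /=; rewrite ?mulr1 ?mulr0.
Qed.

Lemma diag2_unitary p q : `|p| = 1 -> `|q| = 1 -> diag2 p q \is unitarymx.
Proof.
move=> p1 q1; apply/unitarymxP; rewrite tr_diag_mx map_diag_mx mulmx_diag.
apply/matrixP => i j; rewrite !mxE -normCK.
by congr (_ *+ _); do 2 (case: eqP => _; first by rewrite ?p1 ?q1 expr1n);
   rewrite normr1 expr1n.
Qed.

Lemma det_diag2 p q : \det (diag2 p q) = p * q.
Proof.
rewrite det_diag !big_ord_recl !mxE /= big1 ?mulr1// => i _.
by rewrite mxE.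
Qed.

(** The reflection along this vector maps [e_1] to a multiple of [u].  The sign
   is free, so that the coordinate of [hvec] on [e_1] can be kept nonzero. *)
Definition hvec (b : bool) (u : 'cV[C]_n.+2) := e1 + (-1) ^+ b *: u.

Definition reflector b u : 'M[C]_n.+2 :=
  1%:M - ((hvec b u 1 0)^*)^-1 *: (hvec b u *m adj (hvec b u)).

Lemma hvec_sqnorm b u : sphere u ->
  (hvec b u 1 0)^* + (hvec b u 1 0)^*^* = sqnorm (hvec b u).
Proof.
move=> [_ u1]; rewrite conjCK.
(* Termwise, [|x + s y|^2] is expanded for a sign [s] and [x] in {0, 1}. *)
have -> : sqnorm (hvec b u) = \sum_i ((i == 1)%:R *
    (1 + (-1) ^+ b * (u i 0 + (u i 0)^*)) + `|u i 0| ^+ 2).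
  apply: eq_bigr => i _; rewrite !normCK !mxE eqxx andbT rmorphD rmorphM /=.
  rewrite rmorph_nat rmorph_sign.
  have : (-1) ^+ b * (-1) ^+ b = 1 :> C by rewrite -expr2 sqrr_sign.
  move: ((-1) ^+ b : C) => s ss; case: eqP => _ /=; last first.
    by rewrite !add0r mul0r add0r mulrACA ss mul1r.
  by rewrite -[u i 0 * _ in RHS]mul1r -[X in _ = _ + X * _]ss; ring.
rewrite big_split /= -/(sqnorm u) u1 (bigD1 1)//= mul1r big1 ?addr0; last first.
  by move=> i /negbTE ->; rewrite mul0r.
rewrite !mxE /= rmorphD rmorphM /= rmorph1 rmorph_sign.
by ring.
Qed.

Lemma reflector_unitary b u : sphere u -> hvec b u 1 0 != 0 ->
  reflector b u \is unitarymx.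
Proof.
move=> su h0; apply: householder_unitary; first by rewrite conjC_eq0.
exact: hvec_sqnorm.
Qed.

Lemma adj_mul_delta (v : 'cV[C]_n.+2) i :
  adj v *m (delta_mx i 0 : 'cV[C]_n.+2) = (v i 0)^*%:M.
Proof.
by rewrite -colE; apply/matrixP => j k; rewrite !ord1 !mxE mulr1n.
Qed.

Lemma reflector_e0 b u : sphere u -> reflector b u *m e0 = e0.
Proof.
move=> [u0 _]; rewrite mulmxBl mul1mx -scalemxAl -mulmxA adj_mul_delta.
have -> : hvec b u 0 0 = 0 by rewrite !mxE u0 mulr0 addr0.
by rewrite rmorph0 mul_mx_scalar scale0r scaler0 subr0.
Qed.

Lemma reflector_e1 b u : hvec b u 1 0 != 0 ->
  reflector b u *m e1 = - (-1) ^+ b *: u.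
Proof.
move=> h0; rewrite mulmxBl mul1mx -scalemxAl -mulmxA adj_mul_delta.
rewrite mul_mx_scalar scalerA mulVf ?conjC_eq0// scale1r.
by rewrite opprD addNKr scaleNr.
Qed.

(** The diagonal factor multiplies [e_0] by [p] and makes [p u] the image of
   [e_1]; the value of [p^2] is the one which gives determinant 1. *)
Lemma reflector_section b u p : sphere u -> hvec b u 1 0 != 0 ->
  p ^+ 2 = - (-1) ^+ b / \det (reflector b u) ->
  let k := reflector b u *m diag2 p (- (-1) ^+ b * p) in
  K0 R n k /\ ucol k = u.
Proof.
move=> su h0 p2 k; have ur := reflector_unitary su h0.
have ss : (-1) ^+ b * (-1) ^+ b = 1 :> C by rewrite -expr2 sqrr_sign.
have d1 := det_unitary ur.
have d0 : \det (reflector b u) != 0 by rewrite -normr_gt0 d1.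
have p1 : `|p| = 1.
  apply/eqP; rewrite -(@sqrp_eq1 _ `|p|)// -normrX p2 normrM normfV d1 invr1.
  by rewrite mulr1 normrN normr_sign.
have p0 : p != 0 by rewrite -normr_gt0 p1.
have ke0 : k *m e0 = p *: e0.
  by rewrite -mulmxA diag2_e0 -scalemxAr reflector_e0.
have kS : SU R n.+2 k.
  split; last first.
    set s := (-1) ^+ b in p2 ss k ke0 *.
    rewrite det_mulmx det_diag2 (_ : p * _ = - s * p ^+ 2); last by ring.
    rewrite p2; move: (\det _) d0 => d d0.
    rewrite [LHS](_ : _ = s * s * (d * d^-1)); last by move: (d^-1) => d'; ring.
    by rewrite ss mul1r divff.
  apply: (mul_unitarymx ur); apply: (diag2_unitary p1).
  by rewrite normrM normrN normr_sign mul1r.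
set s := (-1) ^+ b in ss k kS ke0 *.
split; first exact: stab_e0_K0 ke0.
rewrite /ucol (entry00 ke0) -mulmxA diag2_e1 -scalemxAr reflector_e1//.
rewrite !scalerA -/s [X in X *: u](_ : _ = s * s * (p^-1 * p)); last first.
  by move: (p^-1) => p'; ring.
by rewrite ss mulVf// mulr1 scale1r.
Qed.

End local_section.

Section continuous_section.
Context (R : realType) (n : nat).
Local Notation C := R[i].

Lemma cvg_hvec (T : Type) (F : set_system T) (b : bool)
    (w : T -> 'cV[C]_n.+2) (u : 'cV[C]_n.+2) : Filter F ->
  w x @[x --> F] --> u -> hvec b (w x) @[x --> F] --> hvec b u.
Proof.
move=> FF wu; apply: cvgD; first exact: cvg_cst.
exact: cvgZl_tmp.
Qed.

Lemma cvg_reflector (T : Type) (F : set_system T) (b : bool)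
    (w : T -> 'cV[C]_n.+2) (u : 'cV[C]_n.+2) : Filter F ->
  hvec b u 1 0 != 0 ->
  w x @[x --> F] --> u -> reflector b (w x) @[x --> F] --> reflector b u.
Proof.
move=> FF h0 wu; have hwu := @cvg_hvec _ _ b _ _ FF wu.
apply: cvgB; first exact: cvg_cst.
apply: cvgZ.
  apply: cvgV; first by rewrite conjC_eq0.
  by apply: cvg_conj; exact: cvg_entry.
by apply: cvg_mulmx => //; exact: cvg_adj.
Qed.

Lemma cvg_diag2 (T : Type) (F : set_system T) (p q : T -> C) (p0 q0 : C) :
  Filter F -> p x @[x --> F] --> p0 -> q x @[x --> F] --> q0 ->
  diag2 n (p x) (q x) @[x --> F] --> diag2 n p0 q0.
Proof.
move=> FF pp qq; apply: cvg_mx => i j.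
have E (a b : C) : diag2 n a b i j =
    if i == j then if i == 0 then a else if i == 1 then b else 1 else 0.
  by rewrite !mxE; case: (eqVneq i j).
under eq_cvg do rewrite E; rewrite E.
case: (i == j); last exact: cvg_cst.
case: (i == 0); first exact: pp.
by case: (i == 1); [exact: qq|exact: cvg_cst].
Qed.

(** The reflector and its determinant are continuous in [u], and the phase
   needed by [reflector_section] is a continuous local square root.  The
   section is taken along an arbitrary family [w] converging to [u0], which is
   the form used to prove continuity into [K_0 / M]. *)
Lemma local_section (T : Type) (F : set_system T) (w : T -> 'cV[C]_n.+2)
    (u0 : 'cV[C]_n.+2) : Filter F -> w x @[x --> F] --> u0 -> sphere u0 ->
  exists (s : T -> 'M[C]_n.+2) (k0 : 'M[C]_n.+2),
    [/\ s x @[x --> F] --> k0, K0 R n k0 /\ ucol k0 = u0 &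
      \forall x \near F, sphere (w x) -> K0 R n (s x) /\ ucol (s x) = w x].
Proof.
move=> FF wu su0.
(* The coordinate is [1 + (-1) ^+ b * u_1], nonzero for one of the signs. *)
have [b h0] : exists b, hvec b u0 1 0 != 0.
  case: (eqVneq (u0 1 0) (-1)) => [u1|u1].
    exists true; rewrite !mxE u1 expr1 mulN1r opprK.
    by rewrite (_ : _ + _ = 2%:R) ?pnatr_eq0.
  by exists false; rewrite !mxE /= expr0 mul1r addrC addr_eq0.
pose g (u : 'cV[C]_n.+2) := - (-1) ^+ b / \det (reflector b u).
have g1 u : sphere u -> hvec b u 1 0 != 0 -> `|g u| = 1.
  move=> su hu; rewrite normrM normrN normr_sign mul1r normfV.
  by rewrite (det_unitary (reflector_unitary su hu)) invr1.
have crefl : reflector b (w x) @[x --> F] --> reflector b u0.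
  exact: cvg_reflector.
have cg : g (w x) @[x --> F] --> g u0.
  apply: cvgM; first exact: cvg_cst.
  apply: cvgV; last exact: cvg_det.
  by rewrite -normr_gt0 (det_unitary (reflector_unitary su0 h0)).
have [p [p0 [cp p02 pg]]] := local_sqrt FF cg (g1 _ su0 h0).
exists (fun x => reflector b (w x) *m diag2 n (p x) (- (-1) ^+ b * p x)).
exists (reflector b u0 *m diag2 n p0 (- (-1) ^+ b * p0)); split.
- apply: cvg_mulmx; first exact: crefl.
  by apply: cvg_diag2; [exact: cp|apply: cvgM; [exact: cvg_cst|exact: cp]].
- exact: (reflector_section su0 h0 p02).
near=> x => su.
have hu : hvec b (w x) 1 0 != 0.
  near: x; apply: (cvgr_neq0 _ _ h0).
  by apply: cvg_entry; exact: cvg_hvec.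
apply: (reflector_section su hu).
move: (g1 _ su hu); near: x; exact: pg.
Unshelve. all: by end_near. Qed.

Lemma ucol_surj (u : 'cV[C]_n.+2) : sphere u ->
  exists2 k, K0 R n k & ucol k = u.
Proof.
move=> su; have [_ [k [_ [kK ku] _]]] :=
  @local_section _ (nbhs u) (fun=> u) u _ (cvg_cst u) su.
by exists k.
Qed.

End continuous_section.

(** * The decomposition of SU(N+1) *)

Section decomposition.
Context (R : realType).
Local Notation C := R[i].

Lemma norm_real_complex (x : R) : `|x%:C| = `|x|%:C.
Proof. by rewrite normc_def /= expr0n addr0 sqrtr_sqr. Qed.

Definition rot2 (c s : C) : 'M[C]_2 :=
  \matrix_(i, j) if i == j then c else if i == 0 then - s else s.

Lemma SO2_SU (B : 'M[C]_2) : SO2 R B -> SU R 2 B.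
Proof.
move=> [Q [QQ dQ] <-]; split; last by rewrite det_map_mx dQ rmorph1.
apply: unitarymx_adj_mul.
have -> : adj (map_mx (real_complex R) Q) = map_mx (real_complex R) Q^T.
  by apply/matrixP => i j; rewrite !mxE; exact: conjc_real.
by rewrite -map_mxM QQ map_mx1.
Qed.

Lemma rot2_SO2 (t : R) : SO2 R (rot2 (cos t)%:C (sin t)%:C).
Proof.
exists (\matrix_(i, j)
    if i == j then cos t else if i == 0 then - sin t else sin t).
  split.
    apply/matrixP => i j; rewrite !mxE !big_ord_recl big_ord0 !mxE addr0.
    have cs := cos2Dsin2 t.
    by case: i => [[|[|//]] ?]; case: j => [[|[|//]] ?] //=;
      rewrite -?expr2 ?sqrrN ?cs ?(addrC (sin t ^+ 2)) ?cs // ?mulNr ?mulrN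
        1?[cos t * _]mulrC ?addrN ?addNr.
  rewrite (expand_det_row _ 0) !big_ord_recl big_ord0 /cofactor !det_mx11 !mxE
    /=.
  by rewrite expr0 expr1 mul1r mulN1r mulrNN addr0 -!expr2 cos2Dsin2.
apply/matrixP => i j; rewrite !mxE.
by case: ifP => // _; case: ifP => // _; rewrite rmorphN.
Qed.

Lemma upper_block_SU n (B : 'M[C]_2) : SU R 2 B -> SU R n.+2 (upper_block n B).
Proof.
move=> [uB dB]; split.
  by apply: (@unitary_block _ 2 n); rewrite ?unitary_scalar ?normr1.
by apply: etrans (@det_lblock _ 2 n _ _ _) _; rewrite dB det1 mulr1.
Qed.

Lemma lower_block_SU n (A : 'M[C]_n.+1) :
  SU R n.+1 A -> SU R n.+2 (lower_block A).
Proof.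
move=> [uA dA]; split.
  by apply: (@unitary_block _ 1 n.+1); rewrite ?unitary_scalar ?normr1.
by apply: etrans (@det_lblock _ 1 n.+1 _ _ _) _; rewrite dA det1 mulr1.
Qed.

Lemma upper_block_ulE n (B : 'M[C]_2) (i j : 'I_2) :
  upper_block n B (lshift n i) (lshift n j) = B i j.
Proof. exact: block_mxEul. Qed.

Lemma rotation_upper_block n (c s : C) :
  rotation n c s = upper_block n (rot2 c s).
Proof.
apply/matrixP => i j; rewrite -(@splitK 2 n i) -(@splitK 2 n j).
case: fintype.split => i'; case: fintype.split => j' /=.
- rewrite upper_block_ulE !mxE.
  rewrite -!val_eqE /=; case: i' => [[|[|//]] ?]; case: j' => [[|[|//]] ?] /=;
    rewrite ?mulr1n ?mulr0n; by ring.
- rewrite [RHS]block_mxEur !mxE -!val_eqE /=.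
  by case: i' => [[|[|//]] ?]; rewrite /= ?andbF ?mulr0n ?mulr1n; ring.
- rewrite [RHS]block_mxEdl !mxE -!val_eqE /=.
  by case: j' => [[|[|//]] ?]; rewrite /= ?andbF ?mulr0n ?mulr1n; ring.
rewrite [RHS]block_mxEdr !mxE -!val_eqE /= eqn_add2l.
by rewrite ?andbF ?mulr0n; ring.
Qed.

Lemma exp_gen_SU n (t : R) : SU R n.+2 (exp_gen n t).
Proof. by rewrite exp_genE rotation_upper_block;
  apply/upper_block_SU/SO2_SU/rot2_SO2. Qed.

Context (n : nat).
Local Notation e0 := (delta_mx 0 0 : 'cV[C]_n.+2).
Local Notation e1 := (delta_mx 1 0 : 'cV[C]_n.+2).

Lemma exp_gen_e0 (t : R) :
  exp_gen n t *m e0 = (cos t)%:C *: e0 + (sin t)%:C *: e1.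
Proof.
apply/matrixP => i j; rewrite ord1 mul_delta_col exp_genE !mxE -!val_eqE /=.
by case: i => [[|[|i]] ?]; rewrite /= ?mulr1n ?mulr0n; ring.
Qed.

Lemma sphere_e1 : sphere e1.
Proof. by split; [rewrite mxE|exact: sqnorm_delta]. Qed.

(** [zeta] is the phase of [z_0], [cos t] its modulus, and [u] the rest of [z]
   divided by [zeta sin t]; if [sin t = 0] the rest vanishes and [u] is
   arbitrary. *)
Lemma polar_form (z : 'cV[C]_n.+2) : sqnorm z = 1 ->
  exists (zeta : C) (t : R) (u : 'cV[C]_n.+2),
    [/\ `|zeta| = 1, sphere u &
       z = zeta *: ((cos t)%:C *: e0 + (sin t)%:C *: u)].
Proof.
move=> z1.
pose w : 'cV[C]_n.+2 := \col_i (if i == 0 then 0 else z i 0).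
pose r : R := Num.sqrt (complex.Re (z 0 0) ^+ 2 + complex.Im (z 0 0) ^+ 2).
have r0 : 0 <= r by exact: sqrtr_ge0.
have rE : `|z 0 0| = r%:C by rewrite normc_def.
have zw : sqnorm z = r%:C ^+ 2 + sqnorm w.
  rewrite /sqnorm (bigD1 0)//= [in RHS](bigD1 0)//= -rE mxE eqxx normr0.
  rewrite expr0n add0r; congr (_ + _).
  by apply: eq_bigr => i /negbTE i0; rewrite mxE i0.
have w2 : sqnorm w = (1 - r ^+ 2)%:C.
  by rewrite rmorphB rmorphXn rmorph1 /= -z1 zw addrC addKr.
have r1 : r ^+ 2 <= 1.
  rewrite -subr_ge0 -lecR rmorph0 -w2.
  by apply: sumr_ge0 => i _; rewrite exprn_ge0.
have r1' : -1 <= r <= 1.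
  rewrite (le_trans _ r0) ?lerN10//=.
  by rewrite -(@ler_pXn2r _ 2) ?nnegrE// expr1n.
pose t := acos r.
have ct : cos t = r by exact: acosK.
pose s := sin t.
have s2 : s ^+ 2 = 1 - r ^+ 2 by rewrite -ct sin2cos2.
pose zeta := if r == 0 then 1 else z 0 0 / r%:C.
have zeta1 : `|zeta| = 1.
  rewrite /zeta; case: eqVneq => [_|rn0]; first exact: normr1.
  rewrite normrM normfV rE norm_real_complex ger0_norm//.
  by rewrite divff// fmorph_eq0.
have zeta0 : zeta != 0 by rewrite -normr_gt0 zeta1.
have zE : z 0 0 = zeta * r%:C.
  rewrite /zeta; case: eqVneq => [re|rn0].
    by apply/eqP; rewrite mul1r re -normr_eq0 rE re.
  by rewrite divfK// fmorph_eq0.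
have zdec : z = z 0 0 *: e0 + w.
  apply/matrixP => i j; rewrite ord1 !mxE eqxx andbT.
  by case: eqVneq => [->|_]; rewrite ?mulr1 ?addr0// mulr0 add0r.
case: (eqVneq s 0) => [se|sn0].
  exists zeta, t, e1; split=> //; first exact: sphere_e1.
  have w0 : w = 0.
    have /eqP : sqnorm w = 0 by rewrite w2 -s2 se expr0n.
    rewrite psumr_eq0; last by move=> i _; rewrite exprn_ge0.
    move=> /allP w0; apply/matrixP => i j; rewrite ord1 [RHS]mxE; apply/eqP.
    by have /= := w0 i (mem_index_enum i); rewrite sqrf_eq0 normr_eq0.
  by rewrite ct -/s se rmorph0 scale0r addr0 scalerA -zE {1}zdec w0 addr0.
have sC0 : s%:C != 0 :> C by rewrite fmorph_eq0.
exists zeta, t, ((zeta * s%:C)^-1 *: w); split=> //.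
  split; first by rewrite !mxE mulr0.
  rewrite sqnormZ normfV normrM zeta1 mul1r w2 -s2 rmorphXn /= exprVn.
  by rewrite norm_real_complex -!rmorphXn real_normK ?num_real// mulVf//
    fmorph_eq0 expf_neq0.
rewrite ct -/s scalerDr !scalerA -zE mulfV ?scale1r//.
by rewrite mulf_neq0.
Qed.

(** The vector [u] of the polar form is [ucol k] for some [k]. *)
Lemma K0_polar (z : 'cV[C]_n.+2) : sqnorm z = 1 ->
  exists (k : 'M[C]_n.+2) (t : R) (c : C),
    [/\ K0 R n k, `|c| = 1 & z = c *: (k *m (exp_gen n t *m e0))].
Proof.
move=> /polar_form[zeta [t [u [z1 su ->]]]].
have [k kK ku] := ucol_surj su.
exists k, t, (zeta / k 0 0); split=> //.
  by rewrite normrM normfV z1 K0_00// divr1.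
rewrite exp_gen_e0 K0_torus// ku scalerA divfK//.
exact: K0_00_neq0.
Qed.

(** If [g e_0 = c k (exp tH) e_0], then [(k exp tH)^-1 g] preserves the line of
   [e_0]. *)
Lemma KAK (g : 'M[C]_n.+2) : SU R n.+2 g ->
  exists (k1 k2 : 'M[C]_n.+2) (t : R),
    [/\ K0 R n k1, K0 R n k2 & g = k1 *m exp_gen n t *m k2].
Proof.
move=> gS; have [ug dg] := gS.
have : sqnorm (g *m e0) = 1 by rewrite sqnorm_unitary ?sqnorm_delta.
move=> /K0_polar[k [t [c [kK c1 gE]]]].
have kS : SU R n.+2 (k *m exp_gen n t).
  by apply: SU_mul; [exact: K0_SU|exact: exp_gen_SU].
have [uk dk] := kS.
exists k, (adj (k *m exp_gen n t) *m g), t; split=> //.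
  apply: (@stab_e0_K0 _ _ _ c); first exact: (SU_mul (SU_adj kS) gS).
  by rewrite -mulmxA gE -scalemxAr (mulmxA k) (mulmxA (adj _)) (unitary_adj_mul
    uk) mul1mx.
by rewrite mulmxA (unitarymxP uk) mul1mx.
Qed.

End decomposition.

(** * Smooth parametrisations of SU(N+1) *)

Section global_maps.
Context (R : realType).
Local Notation C := R[i].

(** The case of a source with one global chart in which [f] is given by a
   formula. *)
Lemma smooth_mx (X : charted R) (i : chart_index X) m n
    (f : X -> matrix_charted R m n) (G : chart_model X -> 'M[C]_(m, n)) :
  (forall x, chart_dom i x) -> CinftyM setT G ->
  (forall x, f x = G (chart_coord i x)) -> smooth f.
Proof.
move=> iT CG fG x.
exists i, tt, setT, (fun p => realify (G p)); split=> //.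
- exact: openT.
- by apply: Cinfty_realify => //; exact: openT.
- by move=> y _ _; split=> //=; rewrite fG.
Qed.

Definition elt (T : Type) (A : set T) (x : T) (Ax : A x) : set_type A :=
  exist (fun x => x \in A) x (mem_set Ax).

Lemma set_val_elt (T : Type) (A : set T) (x : T) (Ax : A x) :
  set_val (elt Ax) = x.
Proof. by rewrite set_valE. Qed.

Lemma elt_eq (T : Type) (A : set T) (x : T) (Ax : A x) (y : set_type A) :
  set_val y = x -> elt Ax = y.
Proof. by move=> yx; apply: val_inj; rewrite /= -yx set_valE. Qed.

Lemma KAK_smooth n : smooth_surjection
  (fun x : set_type (K0 R n) * set_type (exp_a R n) * set_type (K0 R n) =>
     set_val x.1.1 *m set_val x.1.2 *m set_val x.2) (SU R n.+2).
Proof.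
split.
  apply: (@smooth_mx (prod_charted (prod_charted (subset_charted (K0 R n))
     (subset_charted (exp_a R n))) (subset_charted (K0 R n))) (tt, tt, tt) _ _ _
     (fun p => unrealify p.1.1 *m unrealify p.1.2 *m unrealify p.2)) => //.
    have oT : open [set: chart_model (prod_charted (prod_charted
      (subset_charted (K0 R n)) (subset_charted (exp_a R n)))
      (subset_charted (K0 R n)))] by exact: openT.
    apply: CinftyM_mul => //; last first.
      apply: CinftyM_unrealify => //.
      exact: (cont_linear_snd (@cont_linear_id _ _)).
    apply: CinftyM_mul => //; apply: CinftyM_unrealify => //.
      exact: (cont_linear_fst (cont_linear_fst (@cont_linear_id _ _))).
    exact: (cont_linear_snd (cont_linear_fst (@cont_linear_id _ _))).
  by move=> x /=; rewrite !realifyK.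
apply/seteqP; split=> [_ [[[k1 a] k2] _ <-] /=|g gS].
  have [t _ aE] : exp_a R n (set_val a) by exact: set_valP.
  rewrite -aE; apply: SU_mul; last by apply: K0_SU; exact: set_valP.
  apply: SU_mul; last exact: exp_gen_SU.
  by apply: K0_SU; exact: set_valP.
have [k1 [k2 [t [k1K k2K ->]]]] := KAK gS.
have aE : exp_a R n (exp_gen n t) by exists t.
by exists (elt k1K, elt aE, elt k2K).
Qed.

Lemma delta_SU (mu : C) : `|mu| = 1 -> SU R 2 (delta mu).
Proof.
move=> mu1; split.
  by apply: (@unitary_block _ 1 1); apply: unitary_scalar => //;
    rewrite norm_conjC.
apply: etrans (@det_lblock _ 1 1 _ _ _) _.
by rewrite !det_scalar1 -normCK mu1 expr1n.
Qed.

Lemma delta_adj (mu : C) : adj (delta mu) = delta (mu^*).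
Proof.
apply: etrans (congr1 (map_mx Num.conj) (@tr_block_mx _ 1 1 1 1 _ _ _ _)) _.
apply: etrans (@map_block_mx _ _ _ 1 1 1 1 _ _ _ _) _.
by rewrite !trmx0 !map_mx0 !tr_scalar_mx !map_scalar_mx.
Qed.

Lemma upper_block_adj n (B : 'M[C]_2) :
  adj (upper_block n B) = upper_block n (adj B).
Proof.
apply: etrans (congr1 (map_mx Num.conj) (@tr_block_mx _ 2 n 2 n _ _ _ _)) _.
apply: etrans (@map_block_mx _ _ _ 2 n 2 n _ _ _ _) _.
by rewrite !trmx0 !map_mx0 tr_scalar_mx map_scalar_mx rmorph1.
Qed.

Lemma lower_block_adj n (A : 'M[C]_n.+1) :
  adj (lower_block A) = lower_block (adj A).
Proof.
apply: etrans (congr1 (map_mx Num.conj) (@tr_block_mx _ 1 n.+1 1 n.+1 _ _ _ _))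
  _.
apply: etrans (@map_block_mx _ _ _ 1 n.+1 1 n.+1 _ _ _ _) _.
by rewrite !trmx0 !map_mx0 tr_scalar_mx map_scalar_mx rmorph1.
Qed.

Lemma lower_block_mul n (A B : 'M[C]_n.+1) :
  lower_block A *m lower_block B = lower_block (A *m B).
Proof.
apply: etrans (@mulmx_block _ 1 n.+1 1 n.+1 1 n.+1 _ _ _ _ _ _ _ _) _.
by rewrite !mulmx0 !mul0mx !addr0 !add0r mulmx1.
Qed.

Lemma deltaE (mu : C) (i j : 'I_2) :
  delta mu i j = if i == j then if i == 0 then mu else mu^* else 0.
Proof.
rewrite -(@splitK 1 1 i) -(@splitK 1 1 j).
case: fintype.split => i'; case: fintype.split => j' /=;
  rewrite !ord1 -!val_eqE /=.
- by apply: etrans (@block_mxEul _ 1 1 1 1 _ _ _ _ _ _) _; rewrite mxE.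
- by apply: etrans (@block_mxEur _ 1 1 1 1 _ _ _ _ _ _) _; rewrite mxE.
- by apply: etrans (@block_mxEdl _ 1 1 1 1 _ _ _ _ _ _) _; rewrite mxE.
- by apply: etrans (@block_mxEdr _ 1 1 1 1 _ _ _ _ _ _) _; rewrite mxE.
Qed.

Lemma upper_delta n (mu : C) : upper_block n (delta mu) = diag2 n mu (mu^*).
Proof.
apply/matrixP => i j; rewrite -(@splitK 2 n i) -(@splitK 2 n j).
case: fintype.split => i'; case: fintype.split => j' /=.
- rewrite upper_block_ulE deltaE !mxE -!val_eqE /=.
  by case: i' => [[|[|//]] ?]; case: j' => [[|[|//]] ?].
- rewrite [LHS]block_mxEur !mxE -!val_eqE /=.
  by case: i' => [[|[|//]] ?].
- rewrite [LHS]block_mxEdl !mxE -!val_eqE /=.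
  by case: j' => [[|[|//]] ?].
by rewrite [LHS]block_mxEdr !mxE -!val_eqE /= eqn_add2l.
Qed.

Lemma lower_block_mxE n (A : 'M[C]_n.+1) (i j : 'I_n.+1) :
  lower_block A (rshift 1 i) (rshift 1 j) = A i j.
Proof. exact: block_mxEdr. Qed.

(** Dividing [k] by the diagonal element with the same corner entry leaves an
   element of [K_0] which fixes [e_0]. *)
Lemma K0_lower_delta n (k : 'M[C]_n.+2) : K0 R n k ->
  exists (A : 'M[C]_n.+1) (mu : C), [/\ SU R n.+1 A, `|mu| = 1 &
    k = lower_block A *m upper_block n (delta mu)].
Proof.
move=> kK; set mu := k 0 0; have mu1 : `|mu| = 1 := K0_00 kK.
have mu0 : mu != 0 by rewrite -normr_gt0 mu1.
set D := upper_block n (delta mu).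
have DS : SU R n.+2 D by apply: upper_block_SU; exact: delta_SU.
have De : adj D *m (delta_mx 0 0 : 'cV[C]_n.+2) = mu^-1 *: delta_mx 0 0.
  by rewrite upper_block_adj delta_adj upper_delta diag2_e0 conj_unit.
pose h := k *m adj D.
have he : h *m (delta_mx 0 0 : 'cV[C]_n.+2) = 1 *: delta_mx 0 0.
  by rewrite -mulmxA De -scalemxAr K0_e0// scalerA mulVf.
have hK : K0 R n h.
  by apply: stab_e0_K0 he; apply: SU_mul (SU_adj DS); exact: K0_SU.
have [A uA hA] := hK.
have dA : \det A = 1.
  have h00 := entry00 he; apply: invr_inj; rewrite invr1 -h00 -hA.
  transitivity ((block_mx (\det A)^-1%:M 0 0 A : 'M[C]_(1 + n.+1))
    (lshift n.+1 0) (lshift n.+1 0)).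
    by rewrite block_mxEul mxE.
  by congr (fun_of_matrix _ _ _); exact: val_inj.
exists A, mu; split=> //.
have -> : lower_block A = h by rewrite -hA dA invr1.
by rewrite -mulmxA unitary_adj_mul ?mulmx1//; case: DS.
Qed.

Lemma K0_delta_lower n (k : 'M[C]_n.+2) : K0 R n k ->
  exists (A : 'M[C]_n.+1) (mu : C), [/\ SU R n.+1 A, `|mu| = 1 &
    k = upper_block n (delta mu) *m lower_block A].
Proof.
move=> /K0_adj/K0_lower_delta[A [mu [SA mu1 kE]]].
exists (adj A), (mu^*); split; [exact: SU_adj|by rewrite norm_conjC|].
by rewrite -(adjK k) kE adjM upper_block_adj lower_block_adj delta_adj.
Qed.

Definition diag3 m (p q r : C) : 'M[C]_m.+3 :=
  diag_mx (\row_j nth 1 [:: p; q; r] j).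

Lemma diag3_mul m p q r p' q' r' :
  diag3 m p q r *m diag3 m p' q' r' = diag3 m (p * p') (q * q') (r * r').
Proof.
rewrite mulmx_diag; congr diag_mx; apply/rowP => j; rewrite !mxE.
by case: j => [[|[|[|j]]] ?] //=; rewrite nth_nil mulr1.
Qed.

Lemma diag2_diag3 m p q : diag2 m.+1 p q = diag3 m p q 1.
Proof.
congr diag_mx; apply/rowP => j; rewrite !mxE -!val_eqE.
by case: j => [[|[|[|j]]] ?] //=; rewrite nth_nil.
Qed.

Lemma lower_diag2 m p q : lower_block (diag2 m p q) = diag3 m 1 p q.
Proof.
apply/matrixP => i j; rewrite -(@splitK 1 m.+2 i) -(@splitK 1 m.+2 j).
case: fintype.split => i'; case: fintype.split => j' /=.
- by rewrite [LHS]block_mxEul !mxE !ord1 -!val_eqE.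
- by rewrite [LHS]block_mxEur !mxE ord1 -!val_eqE.
- by rewrite [LHS]block_mxEdl !mxE [j']ord1 -!val_eqE.
rewrite lower_block_mxE !mxE -!val_eqE /= eqn_add2l.
by case: i' => [[|[|i']] ?] //=; rewrite nth_nil.
Qed.

(** A scalar 2 x 2 block commutes with every other, in particular with the
   rotation: these diagonal elements centralise [exp a]. *)
Lemma diag3_upper_comm m (s r : C) (B : 'M[C]_2) :
  diag3 m s s r *m upper_block m.+1 B = upper_block m.+1 B *m diag3 m s s r.
Proof.
have -> : diag3 m s s r =
    (block_mx s%:M 0 0 (diag_mx (\row_j nth 1 [:: r] j)) : 'M[C]_(2 + m.+1)).
  apply/matrixP => i j; rewrite -(@splitK 2 m.+1 i) -(@splitK 2 m.+1 j).
  case: fintype.split => i'; case: fintype.split => j' /=.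
  - rewrite [RHS]block_mxEul !mxE -!val_eqE /=.
    by case: i' => [[|[|//]] ?].
  - rewrite [RHS]block_mxEur !mxE -!val_eqE /=.
    by case: i' => [[|[|//]] ?].
  - rewrite [RHS]block_mxEdl !mxE -!val_eqE /=.
    by case: j' => [[|[|//]] ?].
  by rewrite [RHS]block_mxEdr !mxE -!val_eqE /= eqn_add2l.
apply: etrans (@mulmx_block _ 2 m.+1 2 m.+1 2 m.+1 _ _ _ _ _ _ _ _) _.
apply: esym; apply: etrans (@mulmx_block _ 2 m.+1 2 m.+1 2 m.+1 _ _ _ _ _ _ _
  _) _.
by rewrite !mulmx0 !mul0mx !mulmx1 !mul1mx scalar_mxC.
Qed.

(** With [s^2 = nu / mu], insert [diag (s, s, s^-2)] before the rotation and
   its inverse after it.  Both phases become [mu s], and the remaining diagonal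
   factors have corner entry 1 and determinant 1.  The entry [s^-2] is where
   [N >= 2] is used. *)
Lemma balance_phases m (mu nu : C) (B : 'M[C]_2) : `|mu| = 1 -> `|nu| = 1 ->
  exists (s : C) (A1 A2 : 'M[C]_m.+2),
    [/\ `|s| = 1, SU R m.+2 A1, SU R m.+2 A2 &
      upper_block m.+1 (delta mu) *m upper_block m.+1 B *m
        upper_block m.+1 (delta nu) =
      lower_block A1 *m upper_block m.+1 (delta s) *m upper_block m.+1 B *m
        upper_block m.+1 (delta s) *m lower_block A2].
Proof.
move=> mu1 nu1; pose s := sqrtC (nu / mu); pose q := s ^+ 2.
have mu0 : mu != 0 by rewrite -normr_gt0 mu1.
have qE : q = nu / mu by exact: sqrtCK.
have q1 : `|q| = 1 by rewrite qE normrM normfV mu1 nu1 divr1.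
have s1 : `|s| = 1.
  by apply/eqP; rewrite -(@sqrp_eq1 _ `|s|)// -normrX -/q q1.
have s0 : s != 0 by rewrite -normr_gt0 s1.
have q0 : q != 0 by rewrite -normr_gt0 q1.
have qV1 : `|q^-1| = 1 by rewrite normfV q1 invr1.
have nuE : nu = mu * s * s by rewrite -mulrA -expr2 -/q qE mulrC divfK.
exists (mu * s), (diag2 m q q^-1), (diag2 m q^-1 q); split.
- by rewrite normrM mu1 s1 mulr1.
- by split; [exact: diag2_unitary|rewrite det_diag2 divff].
- by split; [exact: diag2_unitary|rewrite det_diag2 mulVf].
rewrite !upper_delta !lower_diag2 !diag2_diag3 diag3_mul.
(* The entries match since [conj (mu s) s^2 = conj mu s] when [|s| = 1]. *)
have -> : diag3 m (1 * (mu * s)) (q * (mu * s)^*) (q^-1 * 1) =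
    diag3 m mu mu^* 1 *m diag3 m s s q^-1.
  rewrite diag3_mul; congr diag3; rewrite ?mul1r ?mulr1//.
  by rewrite rmorphM /= (conj_unit s1) mulrCA /q expr2 mulfK.
rewrite -!mulmxA; congr (_ *m _); rewrite !mulmxA diag3_upper_comm.
rewrite -!mulmxA; congr (_ *m _); rewrite !diag3_mul nuE; congr diag3.
- by rewrite mulr1 mulrC.
- rewrite !rmorphM /= !(conj_unit s1) /q expr2 invfM.
  have E (x y : C) : y != 0 -> x / y / y = y * (x / y * (y^-1 / y)).
    by move=> y0; field.
  exact: E.
- by rewrite mul1r mulVf.
Qed.

Lemma CinftyM_lower (V : normedModType R) (U : set V) n
    (F : V -> 'M[C]_n.+1) : open U ->
  CinftyM U F -> CinftyM U (fun x => lower_block (F x)).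
Proof.
by move=> oU CF; apply: (@CinftyM_block _ _ _ 1 n.+1 1 n.+1) => //;
  exact: CinftyM_cst.
Qed.

Lemma CinftyM_upper (V : normedModType R) (U : set V) n
    (F : V -> 'M[C]_2) : open U ->
  CinftyM U F -> CinftyM U (fun x => upper_block n (F x)).
Proof.
by move=> oU CF; apply: (@CinftyM_block _ _ _ 2 n 2 n) => //;
  exact: CinftyM_cst.
Qed.

Lemma CinftyM_delta (V : normedModType R) (U : set V) (F : V -> C) : open U ->
  CinftyC U F -> CinftyM U (fun x => delta (F x)).
Proof.
move=> oU CF; apply: (@CinftyM_block _ _ _ 1 1 1 1); try exact: CinftyM_cst.
  exact: CinftyM_scalar.
by apply: CinftyM_scalar => //; exact: CinftyC_conj.
Qed.

Lemma delta_param_smooth n :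
  (0 < n)%N -> smooth_surjection
     (fun x : set_type (SU R n.+1) * set_type (circle R) *
              set_type (SO2 R) * set_type (SU R n.+1) =>
        lower_block (set_val x.1.1.1) *m
        upper_block n (delta (set_val x.1.1.2)) *m
        upper_block n (set_val x.1.2) *m
        upper_block n (delta (set_val x.1.1.2)) *m
        lower_block (set_val x.2))
     (SU R n.+2).
Proof.
case: n => // m _; split.
  pose X := prod_charted (prod_charted (prod_charted
    (subset_charted (SU R m.+2)) (subset_charted (circle R)))
    (subset_charted (SO2 R))) (subset_charted (SU R m.+2)).
  have oT : open [set: chart_model X] by exact: openT.
  pose mu (p : chart_model X) : C := p.1.1.2.1 +i* p.1.1.2.2.
  apply: (@smooth_mx X (tt, tt, tt, tt) _ _ _
     (fun p => lower_block (unrealify p.1.1.1) *m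
        upper_block m.+1 (delta (mu p)) *m
        upper_block m.+1 (unrealify p.1.2) *m
        upper_block m.+1 (delta (mu p)) *m
        lower_block (unrealify p.2))) => //.
    have l1 := cont_linear_fst (@cont_linear_id _ (chart_model X)).
    have l11 := cont_linear_fst l1.
    have Cmu : CinftyM setT (fun p => upper_block m.+1 (delta (mu p))).
      apply: CinftyM_upper => //; apply: CinftyM_delta => //.
      have l12 := cont_linear_snd l11.
      split; [exact: Cinfty_cont_linear oT (cont_linear_fst l12)|].
      exact: Cinfty_cont_linear oT (cont_linear_snd l12).
    apply: CinftyM_mul => //; last first.
      apply: CinftyM_lower => //; apply: CinftyM_unrealify => //.
      exact: (cont_linear_snd (@cont_linear_id _ _)).
    apply: CinftyM_mul => //; apply: CinftyM_mul => //.
      apply: CinftyM_mul => //.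
      apply: CinftyM_lower => //; apply: CinftyM_unrealify => //.
      exact: (cont_linear_fst l11).
    apply: CinftyM_upper => //; apply: CinftyM_unrealify => //.
    exact: (cont_linear_snd l1).
  move=> x /=; rewrite !realifyK /mu /=.
  by case: (set_val x.1.1.2).
apply/seteqP; split=> [_ [[[[A1 mu] B] A2] _ <-] /=|g gS].
  have SA1 : SU R m.+2 (set_val A1) by exact: set_valP.
  have SA2 : SU R m.+2 (set_val A2) by exact: set_valP.
  have mu1 : `|set_val mu| = 1 by exact: (set_valP mu).
  have SB : SO2 R (set_val B) by exact: set_valP.
  have SD := upper_block_SU m.+1 (delta_SU mu1).
  apply: (SU_mul _ (lower_block_SU SA2)); apply: (SU_mul _ SD).
  apply: (SU_mul _ (upper_block_SU _ (SO2_SU SB))); apply: (SU_mul _ SD).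
  exact: lower_block_SU.
have [k1 [k2 [t [k1K k2K ->]]]] := KAK gS.
have [A1 [mu [SA1 mu1 ->]]] := K0_lower_delta k1K.
have [A2 [nu [SA2 nu1 ->]]] := K0_delta_lower k2K.
rewrite exp_genE rotation_upper_block; have SB := rot2_SO2 t.
move: (rot2 _ _) SB => B SB.
have [s [B1 [B2 [s1 SB1 SB2 sE]]]] := balance_phases m B mu1 nu1.
have cs : circle R s by exact: s1.
exists (elt (SU_mul SA1 SB1), elt cs, elt SB, elt (SU_mul SB2 SA2)) => //=.
rewrite !set_val_elt -!lower_block_mul.
set L1 := lower_block A1; set L2 := lower_block A2.
rewrite [RHS](_ : _ = L1 *m (upper_block m.+1 (delta mu) *m
  upper_block m.+1 B *m upper_block m.+1 (delta nu)) *m L2).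
  by rewrite sE !mulmxA.
by rewrite !mulmxA.
Qed.

End global_maps.

(** * Projective space *)

Section quotient_by_kernel.
Context (T : topologicalType) (U : Type) (p : T -> U).

Lemma ker_class_eq (x y : T) : ker_class p x = ker_class p y <-> p x = p y.
Proof.
split=> [/eqmodP/asboolP//|pxy].
by apply/eqmodP/asboolP.
Qed.

Lemma ker_class_repr (q : ker_quot p) : ker_class p (repr q) = q.
Proof. exact: reprK. Qed.

Lemma ker_class_continuous : continuous (ker_class p).
Proof. exact: pi_continuous. Qed.

(** Over an open set, the projection of a quotient is again a quotient map. *)
Lemma ker_quot_continuous_on (Z : topologicalType) (V : set (ker_quot p))
    (g : ker_quot p -> Z) : open V ->
  (forall x, V (ker_class p x) ->
     g (ker_class p y) @[y --> x] --> g (ker_class p x)) ->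
  forall q, V q -> g r @[r --> q] --> g q.
Proof.
move=> oV cg q Vq P; rewrite {1}nbhsE => -[P' [oP' P'q] sP].
have oW : open (V `&` g @^-1` P').
  suff : open (ker_class p @^-1` (V `&` g @^-1` P')) by [].
  rewrite openE => x [Vx gx]; apply: filterI.
    exact: (ker_class_continuous (open_nbhs_nbhs (conj oV Vx))).
  by apply: (cg _ Vx); exact: open_nbhs_nbhs.
apply: (@filterS _ (nbhs q) _ (V `&` g @^-1` P')).
  by move=> r [_ /sP].
by apply: open_nbhs_nbhs; split.
Qed.

End quotient_by_kernel.

Section subsets.
Context (T : topologicalType) (A : set T).

Lemma cvg_set_type (S : Type) (F : set_system S) (y : S -> set_type A)
    (y0 : set_type A) : Filter F ->
  set_val (y x) @[x --> F] --> set_val y0 -> y x @[x --> F] --> y0.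
Proof.
move=> FF yy P [P' [[B oB <-] By0] sP].
have := yy _ (open_nbhs_nbhs (conj oB By0)).
by apply: (@filterS _ F FF) => x Bx; apply: sP.
Qed.

Lemma set_val_continuous : continuous (set_val : set_type A -> T).
Proof. exact: initial_continuous. Qed.

End subsets.

Section projective.
Context (R : realType) (n : nat).
Local Notation C := R[i].
Local Notation e0 := (delta_mx 0 0 : 'cV[C]_n.+2).
Local Notation e1 := (delta_mx 1 0 : 'cV[C]_n.+2).
Implicit Types (v w : 'cV[C]_n.+2) (l : CP R n).

Lemma rep_neq0 l : rep l != 0.
Proof. exact: (set_valP (repr (l : ker_quot (@line R n)))). Qed.

Lemma point_of_rep l : point_of (rep l) = l.
Proof.
rewrite /point_of.
have -> : insubd (e0_pt R n) (rep l) = repr (l : ker_quot (@line R n)).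
  by apply: val_inj; rewrite insubdK//; apply/mem_set/rep_neq0.
exact: ker_class_repr.
Qed.

Lemma line_eq (x y : set_type (nonzero R n)) : line x = line y <->
  exists2 c : C, c != 0 & set_val x = c *: set_val y.
Proof.
split=> [/seteqP[+ _]|[c c0 xy]].
  have xx : line x (set_val x) by exists 1 => //; rewrite scale1r.
  move=> /(_ _ xx) [c _ cE]; exists c => //.
  have x0 : set_val x != 0 := set_valP x.
  by apply: contraNneq x0 => c0; rewrite -cE c0 scale0r.
apply/seteqP; split=> _ [d _ <-].
  by exists (d * c) => //; rewrite xy scalerA.
by exists (d / c) => //; rewrite xy scalerA divfK.
Qed.

Lemma insubd_val v : v != 0 -> set_val (insubd (e0_pt R n) v) = v.
Proof. by move=> v0; apply: insubdK; exact/mem_set. Qed.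

Lemma ker_class_point_of (x : set_type (nonzero R n)) :
  ker_class (@line R n) x = point_of (set_val x).
Proof.
rewrite /point_of; congr ker_class; apply: val_inj.
by apply/esym/insubd_val; exact: (set_valP x).
Qed.

Lemma point_of_scale (c : C) v : c != 0 -> point_of (c *: v) = point_of v.
Proof.
move=> c0; case: (eqVneq v 0) => [->|v0]; first by rewrite scaler0.
apply/ker_class_eq/line_eq; exists c => //.
by rewrite !insubd_val// scaler_eq0 negb_or c0.
Qed.

Lemma rep_point_of v : v != 0 ->
  exists2 c : C, c != 0 & rep (point_of v) = c *: v.
Proof.
move=> v0; have := ker_class_repr (point_of v : ker_quot (@line R n)).
rewrite [in RHS]/point_of => /ker_class_eq/line_eq[c c0 E].
by exists c => //; rewrite /rep E insubd_val.
Qed.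

Lemma act_point_of (g : 'M[C]_n.+2) v : v != 0 ->
  act g (point_of v) = point_of (g *m v).
Proof.
move=> v0; rewrite /act; have [c c0 ->] := rep_point_of v0.
by rewrite -scalemxAr point_of_scale.
Qed.

Lemma rep_entry (v : 'cV[C]_n.+2) i : v != 0 ->
  (rep (point_of v) i 0 != 0) = (v i 0 != 0).
Proof.
by move=> /rep_point_of[c c0 ->]; rewrite mxE mulf_eq0 negb_or c0.
Qed.

Lemma normalize_rep (v : 'cV[C]_n.+2) i : v != 0 ->
  (rep (point_of v) i 0)^-1 *: rep (point_of v) = (v i 0)^-1 *: v.
Proof.
move=> /rep_point_of[c c0 ->]; rewrite mxE scalerA invfM.
by rewrite mulrAC mulVf// mul1r.
Qed.

(** The coordinates normalised by [z_0 = 1]; meaningless on the hyperplane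
   [z_0 = 0]. *)
Definition aff l : 'cV[C]_n.+2 := (rep l 0 0)^-1 *: rep l.

Lemma aff_point_of v : v != 0 -> aff (point_of v) = (v 0 0)^-1 *: v.
Proof.
exact: normalize_rep.
Qed.

Lemma point_of_aff l : rep l 0 0 != 0 -> point_of (aff l) = l.
Proof. by move=> l0; rewrite point_of_scale ?invr_eq0// point_of_rep. Qed.

Lemma aff00 l : rep l 0 0 != 0 -> aff l 0 0 = 1.
Proof. by move=> l0; rewrite mxE mulVf. Qed.

Lemma point_of_cvg (T : Type) (F : set_system T) (w : T -> 'cV[C]_n.+2) v :
  Filter F -> w x @[x --> F] --> v -> v != 0 ->
  point_of (w x) @[x --> F] --> (point_of v : CP R n).
Proof.
move=> FF wv v0.
pose nz u : set_type (nonzero R n) := insubd (e0_pt R n) u.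
suff H : nz (w x) @[x --> F] --> nz v.
  exact: (cvg_comp _ _ H (@ker_class_continuous _ _ (@line R n) _)).
apply: cvg_set_type; rewrite /nz insubd_val//.
apply: (cvg_trans _ wv); apply: near_eq_cvg; near=> x.
rewrite /= insubd_val//; near: x.
exact: (cvgr_neq0 _ wv v0).
Unshelve. all: by end_near. Qed.

Lemma open_affine : open [set l : CP R n | rep l 0 0 != 0].
Proof.
suff : open (ker_class (@line R n) @^-1` [set l | rep l 0 0 != 0]) by [].
rewrite openE => x xV.
have E (y : set_type (nonzero R n)) :
    (rep (ker_class (@line R n) y : CP R n) 0 0 != 0) = (set_val y 0 0 != 0).
  by rewrite ker_class_point_of rep_entry//; exact: (set_valP y).
rewrite /= E in xV.
near=> y; rewrite /= E; near: y.
apply: (cvgr_neq0 _ _ xV).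
apply: cvg_entry; exact: set_val_continuous.
Unshelve. all: by end_near. Qed.

End projective.

(** * The torus in affine coordinates *)

Section polar_coordinates.
Context (R : realType) (n : nat).
Local Notation C := R[i].
Local Notation e0 := (delta_mx 0 0 : 'cV[C]_n.+2).
Local Notation e1 := (delta_mx 1 0 : 'cV[C]_n.+2).
Implicit Types (u v w : 'cV[C]_n.+2) (l : CP R n).

Lemma aff_cvg l : rep l 0 0 != 0 -> aff r @[r --> l] --> aff l.
Proof.
move: l; apply: (@ker_quot_continuous_on _ _ (@line R n) _ _ (@aff R n)
  (@open_affine R n)).
move=> x; rewrite /= ker_class_point_of => xV.
have E (y : set_type (nonzero R n)) :
    aff (ker_class (@line R n) y) = (set_val y 0 0)^-1 *: set_val y.
  by rewrite ker_class_point_of aff_point_of//; exact: (set_valP y).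
rewrite rep_entry in xV; last exact: (set_valP x).
have := @cvg_normalize_entry _ _ (nbhs x) _ _ set_val (set_val x) 0 xV
  (@set_val_continuous _ _ x).
rewrite -ker_class_point_of E => /(_ (nbhs_filter x)).
by rewrite (_ : (fun y => _) = (fun y => aff (ker_class (@line R n) y)))//;
  apply/funext => y; rewrite E.
Qed.

Lemma rep00_near l : rep l 0 0 != 0 -> \forall r \near l, rep r 0 0 != 0.
Proof. by move=> l0; apply: open_nbhs_nbhs; split => //; exact:
  open_affine. Qed.

Lemma l0E : l0 R n = point_of e0. Proof. by []. Qed.

Lemma delta_neq0 (i : 'I_n.+2) : (delta_mx i 0 : 'cV[C]_n.+2) != 0.
Proof.
by apply/eqP => /matrixP/(_ i 0)/eqP; rewrite !mxE !eqxx oner_eq0.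
Qed.

(** Where polar coordinates exist: in the affine chart [z_0 = 1] this is the
   complement of the origin ([cellP]). *)
Definition cell : set (CP R n) := ~` ([set l0 R n] `|` @polar_l0 R n).

Lemma cellP l : cell l <-> rep l 0 0 != 0 /\ aff l - e0 != 0.
Proof.
rewrite subr_eq0; split=> [lc|[l00 a0] [/= ll0|/= lp]].
- have l00 : rep l 0 0 != 0.
    by apply/eqP => l0; apply: lc; right.
  split=> //; apply/eqP => a0; apply: lc; left.
  by rewrite /= -(point_of_aff l00) a0.
- move: a0; rewrite ll0 l0E aff_point_of ?delta_neq0// mxE !eqxx invr1 scale1r.
  by rewrite eqxx.
- by rewrite lp eqxx in l00.
Qed.

Lemma open_cell : open cell.
Proof.
rewrite openE => l /cellP[l00 a0].
near=> r; apply/cellP; split.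
  by near: r; exact: rep00_near.
near: r; have := aff_cvg l00; move: (nbhs l) (nbhs_filter l) => F FF ca.
apply: (cvgr_neq0 _ _ a0).
by apply: cvgB; [exact: ca|exact: cvg_cst].
Unshelve. all: by end_near. Qed.

Lemma point_torus_neq0 (t : R) u : sphere u ->
  (cos t)%:C *: e0 + (sin t)%:C *: u != 0.
Proof.
move=> [u0 u1]; apply/eqP => E.
have c0 : (cos t)%:C = 0 :> C.
  by move/matrixP: E => /(_ 0 0); rewrite !mxE u0 mulr0 addr0 mulr1.
have s0 : (sin t)%:C = 0 :> C.
  move: E; rewrite c0 scale0r add0r => /eqP; rewrite scaler_eq0.
  move=> /orP[/eqP//|/eqP uz]; move: u1; rewrite uz /sqnorm big1 => [/eqP|i _].
    by rewrite eq_sym oner_eq0.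
  by rewrite mxE normr0 expr0n.
have := cos2Dsin2 t.
have -> : cos t = 0 by apply: (@complexI R); rewrite c0 rmorph0.
have -> : sin t = 0 by apply: (@complexI R); rewrite s0 rmorph0.
by move/eqP; rewrite expr0n addr0 eq_sym oner_eq0.
Qed.

Lemma torusP (a : CP R n) : torus R n a ->
  exists t : R, a = point_of ((cos t)%:C *: e0 + (sin t)%:C *: e1).
Proof.
move=> [_ [t _ <-] <-]; exists t.
by rewrite l0E act_point_of ?delta_neq0// exp_gen_e0.
Qed.

Lemma act_torus (k : 'M[C]_n.+2) (t : R) : K0 R n k ->
  act k (point_of ((cos t)%:C *: e0 + (sin t)%:C *: e1)) =
  point_of ((cos t)%:C *: e0 + (sin t)%:C *: ucol k).
Proof.
move=> kK; rewrite act_point_of; last exact/point_torus_neq0/sphere_e1.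
by rewrite K0_torus// point_of_scale// K0_00_neq0.
Qed.

Definition slope (a : CP R n) : R := complex.Re (aff a 1 0).

Lemma rep00_torus (t : R) u : sphere u ->
  (rep (point_of ((cos t)%:C *: e0 + (sin t)%:C *: u)) 0 0 != 0) = (cos t != 0).
Proof.
move=> su; rewrite rep_entry ?point_torus_neq0//.
by case: su => u0 _; rewrite !mxE u0 mulr0 addr0 eqxx mulr1 fmorph_eq0.
Qed.

Lemma aff_torus (t : R) u : sphere u ->
  aff (point_of ((cos t)%:C *: e0 + (sin t)%:C *: u)) =
  (cos t)%:C^-1 *: ((cos t)%:C *: e0 + (sin t)%:C *: u).
Proof.
move=> su; rewrite aff_point_of ?point_torus_neq0//.
by case: su => u0 _; rewrite !mxE u0 mulr0 addr0 eqxx mulr1.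
Qed.

Lemma slope_torus (t : R) :
  slope (point_of ((cos t)%:C *: e0 + (sin t)%:C *: e1)) = tan t.
Proof.
rewrite /slope aff_torus; last exact: sphere_e1.
rewrite [X in complex.Re X](_ : _ = (tan t)%:C)//.
rewrite mxE mxE [X in X + _]mxE [X in _ + X]mxE.
have -> : e0 1 0 = 0 by rewrite mxE.
have -> : e1 1 0 = 1 by rewrite mxE.
by rewrite mulr0 add0r mulr1 -fmorphV -rmorphM mulrC.
Qed.

Lemma point_of_tan (t : R) u : cos t != 0 ->
  point_of ((cos t)%:C *: e0 + (sin t)%:C *: u) =
  point_of (e0 + (tan t)%:C *: u).
Proof.
move=> c0; have cC0 : (cos t)%:C != 0 :> C by rewrite fmorph_eq0.
have cV0 : (cos t)%:C^-1 != 0 :> C by rewrite invr_eq0.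
rewrite -(point_of_scale _ cV0) scalerDr !scalerA (mulVf cC0) scale1r.
by rewrite -fmorphV -rmorphM mulrC.
Qed.

(** Off the hyperplane [z_0 = 0] one may divide by [cos t]. *)
Lemma act_slope (k : 'M[C]_n.+2) (a : CP R n) : K0 R n k -> torus R n a ->
  rep a 0 0 != 0 -> act k a = point_of (e0 + (slope a)%:C *: ucol k).
Proof.
move=> kK /torusP[t ->]; rewrite rep00_torus; last exact: sphere_e1.
move=> c0; rewrite (act_torus t kK) slope_torus.
exact: point_of_tan.
Qed.

Lemma torus_slope (a : CP R n) : torus R n a -> rep a 0 0 != 0 ->
  a = point_of (e0 + (slope a)%:C *: e1).
Proof.
move=> /torusP[t ->]; rewrite rep00_torus; last exact: sphere_e1.
move=> c0; rewrite slope_torus.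
exact: point_of_tan.
Qed.

Lemma affine_neq0 u : u 0 0 = 0 -> e0 + u != 0.
Proof.
move=> u0; apply/eqP => /matrixP/(_ 0 0)/eqP.
by rewrite !mxE u0 addr0 !eqxx oner_eq0.
Qed.

Lemma aff_affine u : u 0 0 = 0 -> aff (point_of (e0 + u)) = e0 + u.
Proof.
move=> u0; rewrite aff_point_of ?affine_neq0// mxE u0 addr0 mxE !eqxx.
by rewrite invr1 scale1r.
Qed.

Lemma rep00_affine u : u 0 0 = 0 -> rep (point_of (e0 + u)) 0 0 != 0.
Proof.
move=> u0; rewrite rep_entry ?affine_neq0// mxE u0 addr0 mxE !eqxx.
exact: oner_neq0.
Qed.

Lemma affine_torus (r : R) : torus R n (point_of (e0 + r%:C *: e1)).
Proof.
exists (exp_gen n (atan r)); first by exists (atan r).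
have c0 : cos (atan r) != 0 by rewrite gt_eqF// cos_gt0_pihalf//; case:
  (atan_def r).
rewrite l0E act_point_of ?delta_neq0// exp_gen_e0.
by rewrite (point_of_tan _ c0) atanK.
Qed.

Definition torus_point (r : R) : set_type (torus R n) := elt (affine_torus r).

Lemma slope_torus_pointE (r : R) : slope (set_val (torus_point r)) = r.
Proof.
rewrite set_val_elt /slope aff_affine; last by rewrite !mxE mulr0.
rewrite [X in complex.Re X](_ : _ = r%:C)// mxE [X in _ + X]mxE.
have -> : e0 1 0 = 0 by rewrite mxE.
have -> : e1 1 0 = 1 by rewrite mxE.
by rewrite mulr1 add0r.
Qed.

End polar_coordinates.

(** * Topology of K_0 / M *)

Section coset_topology.
Context (R : realType) (n : nat).
Local Notation C := R[i].
Local Notation e0 := (delta_mx 0 0 : 'cV[C]_n.+2).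
Local Notation e1 := (delta_mx 1 0 : 'cV[C]_n.+2).
Implicit Types (u v w : 'cV[C]_n.+2) (l : CP R n) (c : K0modM R n).

Lemma toK0modM_eq (k k' : set_type (K0 R n)) :
  toK0modM k = toK0modM k' <-> ucol (set_val k) = ucol (set_val k').
Proof. exact: iff_trans (ker_class_eq _ _ _) (left_coset_eq _ _). Qed.

(** Independent of the representative by [left_coset_eq]; it identifies
   [K_0 / M] with the sphere. *)
Definition coset_col c : 'cV[C]_n.+2 :=
  ucol (set_val (repr (c : ker_quot (@left_coset R n)))).

Lemma coset_col_class (k : set_type (K0 R n)) :
  coset_col (toK0modM k) = ucol (set_val k).
Proof. by apply/toK0modM_eq; exact: ker_class_repr. Qed.

Lemma coset_col_sphere c : sphere (coset_col c).
Proof. by apply: ucol_sphere; exact: set_valP. Qed.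

Lemma coset_col_inj : injective coset_col.
Proof.
move=> c c' /toK0modM_eq; rewrite /toK0modM.
rewrite (ker_class_repr (c : ker_quot _)).
by rewrite (ker_class_repr (c' : ker_quot _)).
Qed.

Lemma cvg_ucol (T : Type) (F : set_system T) (k : T -> 'M[C]_n.+2)
    (k0 : 'M[C]_n.+2) : Filter F -> k0 0 0 != 0 ->
  k x @[x --> F] --> k0 -> ucol (k x) @[x --> F] --> ucol k0.
Proof.
move=> FF k00 kk; apply: cvgZ.
  by apply: cvgV; [exact: k00|exact: cvg_entry].
by apply: cvg_mulmx; [exact: kk|exact: cvg_cst].
Qed.

Lemma coset_col_continuous : continuous coset_col.
Proof.
move=> c; apply: (@ker_quot_continuous_on _ _ (@left_coset R n) _ setT
  coset_col).
- exact: openT.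
- move=> k _; rewrite (coset_col_class k).
  have := @cvg_ucol _ (nbhs k) set_val (set_val k) (nbhs_filter k)
    (K0_00_neq0 (set_valP k)) (@set_val_continuous _ _ k).
  rewrite (_ : (fun y => _) = (fun y => coset_col (toK0modM y)))//.
  by apply/funext => y; rewrite coset_col_class.
- by [].
Qed.

Lemma K0_one : K0 R n 1%:M.
Proof.
apply: (@stab_e0_K0 _ _ _ 1); last by rewrite mul1mx scale1r.
by split; [apply: unitary_scalar; rewrite normr1|exact: det1].
Qed.

(** On the sphere the default value is not used, by [ucol_surj]. *)
Definition coset_of_col u : K0modM R n :=
  toK0modM (xget (elt K0_one) [set k : set_type (K0 R n) |
    ucol (set_val k) = u]).

Lemma coset_of_colK u : sphere u -> coset_col (coset_of_col u) = u.
Proof.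
move=> su; rewrite coset_col_class; have [k kK ku] := ucol_surj su.
apply: (@xgetPex _ (elt K0_one) [set k : set_type (K0 R n) |
  ucol (set_val k) = u]).
by exists (elt kK); rewrite /= set_val_elt.
Qed.

Lemma coset_of_col_class (k : set_type (K0 R n)) u : ucol (set_val k) = u ->
  coset_of_col u = toK0modM k.
Proof.
move=> ku; apply: coset_col_inj; rewrite coset_col_class ku coset_of_colK// -ku.
by apply: ucol_sphere; exact: set_valP.
Qed.

(** Near the limit the coset is the class of a continuous local section. *)
Lemma coset_of_col_cvg (T : Type) (F : set_system T) (w : T -> 'cV[C]_n.+2)
    (u0 : 'cV[C]_n.+2) : Filter F -> w x @[x --> F] --> u0 -> sphere u0 ->
  (\forall x \near F, sphere (w x)) ->
  coset_of_col (w x) @[x --> F] --> (coset_of_col u0 : K0modM R n).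
Proof.
move=> FF wu su0 sw.
have [s [k0 [sk [k0K k0u] near_s]]] := local_section FF wu su0.
pose y x : set_type (K0 R n) := insubd (elt K0_one) (s x).
have yE x : K0 R n (s x) -> set_val (y x) = s x.
  by move=> sK; apply: insubdK; exact/mem_set.
have yk : y x @[x --> F] --> elt k0K.
  apply: cvg_set_type; rewrite set_val_elt.
  apply: (cvg_trans _ sk); apply: near_eq_cvg; near=> x.
  have sx : sphere (w x) by near: x.
  have [sK _] : K0 R n (s x) /\ ucol (s x) = w x.
    by move: sx; near: x.
  by rewrite yE.
have -> : coset_of_col u0 = toK0modM (elt k0K).
  by apply: coset_of_col_class; rewrite set_val_elt.
have H := cvg_comp _ _ yk (@ker_class_continuous _ _ (@left_coset R n) (elt
  k0K)).
apply: (cvg_trans _ H); apply: near_eq_cvg; near=> x.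
have sx : sphere (w x) by near: x.
have [sK su] : K0 R n (s x) /\ ucol (s x) = w x.
  by move: sx; near: x.
by apply/esym/coset_of_col_class; rewrite yE.
Unshelve. all: by end_near. Qed.

Definition len v : R := Num.sqrt (complex.Re (sqnorm v)).

Lemma sqnormE v : sqnorm v = (complex.Re (sqnorm v))%:C.
Proof.
by rewrite RRe_real// ger0_real// sumr_ge0// => i _; rewrite exprn_ge0.
Qed.

Lemma len_sqr v : (len v)%:C ^+ 2 = sqnorm v.
Proof.
have h : 0 <= complex.Re (sqnorm v).
  rewrite -lecR rmorph0 -sqnormE.
  by rewrite sumr_ge0// => i _; rewrite exprn_ge0.
by rewrite -rmorphXn /= sqr_sqrtr// -sqnormE.
Qed.

Lemma len_scale (t : R) u : sphere u -> len (t%:C *: u) = `|t|.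
Proof.
move=> [_ u1]; rewrite /len sqnormZ u1 mulr1 norm_real_complex -rmorphXn/=.
by rewrite real_normK ?num_real// sqrtr_sqr.
Qed.

Lemma len_gt0 v : v != 0 -> 0 < len v.
Proof.
move=> v0; rewrite lt_neqAle sqrtr_ge0 andbT eq_sym.
apply: contraNneq v0 => l0; have := len_sqr v.
rewrite l0 rmorph0 expr0n => /esym/eqP.
rewrite psumr_eq0; last by move=> i _; rewrite exprn_ge0.
move=> /allP w0; apply/eqP/matrixP => i j; rewrite ord1 [RHS]mxE; apply/eqP.
by have /= := w0 i (mem_index_enum i); rewrite sqrf_eq0 normr_eq0.
Qed.

Lemma cvg_Re (T : Type) (F : set_system T) (f : T -> C) (a : C) : Filter F ->
  f x @[x --> F] --> a -> complex.Re (f x) @[x --> F] --> (complex.Re a : R).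
Proof.
move=> FF fa; apply/cvgrPdist_lt => e e0.
have e0C : 0 < e%:C :> C by rewrite -(rmorph0 (real_complex R)) ltcR.
have := (@cvgrPdist_lt _ _ _ _ _ _ a).1 fa _ e0C => /(_ FF).
apply: filterS => x; rewrite -ltcR; apply: le_lt_trans.
by rewrite (le_trans _ (normc_ge_Re _))// raddfB.
Qed.

Lemma cvg_len (T : Type) (F : set_system T) (w : T -> 'cV[C]_n.+2) v :
  Filter F -> w x @[x --> F] --> v -> len (w x) @[x --> F] --> len v.
Proof.
move=> FF wv.
have H : complex.Re (sqnorm (w x)) @[x --> F] --> complex.Re (sqnorm v).
  apply: cvg_Re.
  have E u : sqnorm u = (adj u *m u) 0 0 by rewrite adj_mul_self mxE mulr1n.
  under eq_cvg do rewrite E; rewrite E.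
  by apply: cvg_entry; apply: cvg_mulmx; [exact: cvg_adj|exact: wv].
exact: (cvg_comp _ _ H (@sqrt_continuous _ _)).
Qed.

End coset_topology.

(** * The double covering *)

Section orbit_map.
Context (R : realType) (n : nat).
Local Notation C := R[i].
Local Notation e0 := (delta_mx 0 0 : 'cV[C]_n.+2).
Local Notation e1 := (delta_mx 1 0 : 'cV[C]_n.+2).
Implicit Types (u v w : 'cV[C]_n.+2) (l : CP R n) (c : K0modM R n).
Implicit Types (x : K0modM R n * set_type (torus R n)) (b : bool).

(** The choice of a representative does not matter ([orbit_map_class]). *)
Definition orbit_map x : CP R n :=
  act (set_val (repr (x.1 : ker_quot (@left_coset R n)))) (set_val x.2).

Lemma orbit_map_class (k : set_type (K0 R n)) (a : set_type (torus R n)) :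
  orbit_map (toK0modM k, a) = act (set_val k) (set_val a).
Proof.
have aT : torus R n (set_val a) by exact: set_valP.
rewrite /orbit_map /=; have [t ->] := torusP aT.
rewrite (act_torus _ (set_valP k)) -coset_col_class.
by rewrite (act_torus _ (set_valP (repr (toK0modM k : ker_quot _)))).
Qed.

Lemma orbit_map_slope x : rep (set_val x.2) 0 0 != 0 ->
  orbit_map x = point_of (e0 + (slope (set_val x.2))%:C *: coset_col x.1).
Proof.
by move=> x0; rewrite /orbit_map act_slope//; exact: set_valP.
Qed.

Lemma sqnorm_normalize v : v != 0 -> sqnorm ((len v)^-1%:C *: v) = 1.
Proof.
move=> /len_gt0 v0; rewrite sqnormZ norm_real_complex -len_sqr -rmorphXn
  -rmorphXn.
rewrite -rmorphM /= real_normK ?num_real// exprVn mulVf ?rmorph1//.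
by rewrite expf_neq0// gt_eqF.
Qed.

Lemma orbit_map_surj l : exists x, orbit_map x = l.
Proof.
have z0 := rep_neq0 l; have lz0 := len_gt0 z0.
have [k [t [d [kK d1 E]]]] := K0_polar (sqnorm_normalize z0).
have aT : torus R n (act (exp_gen n t) (l0 R n)).
  by exists (exp_gen n t) => //; exists t.
exists (toK0modM (elt kK), elt aT).
rewrite orbit_map_class !set_val_elt l0E act_point_of ?delta_neq0//.
rewrite act_point_of; last first.
  by rewrite exp_gen_e0; apply: point_torus_neq0; exact: sphere_e1.
have d0 : d != 0 by rewrite -normr_gt0 d1.
rewrite -(point_of_scale _ d0) -E point_of_scale ?point_of_rep//.
by rewrite fmorph_eq0 invr_eq0 gt_eqF.
Qed.

(** [b] encodes the sign of the slope: positive for [false]. *)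
Definition sheet b : set (K0modM R n * set_type (torus R n)) :=
  [set x | rep (set_val x.2) 0 0 != 0 /\ 0 < (-1) ^+ b * slope (set_val x.2)].

Lemma cvg_slope (T : Type) (F : set_system T) (a : T -> CP R n) (a0 : CP R n) :
  Filter F -> rep a0 0 0 != 0 -> a x @[x --> F] --> a0 ->
  slope (a x) @[x --> F] --> slope a0.
Proof.
move=> FF a00 aa; have H : aff (a x) @[x --> F] --> aff a0.
  exact: (cvg_comp _ _ aa (aff_cvg a00)).
by apply: cvg_Re; apply: cvg_entry; exact: H.
Qed.

Lemma cvg_torus_val x :
  set_val y.2 @[y --> x] --> (set_val x.2 : CP R n).
Proof.
have H : y.2 @[y --> x] --> x.2 by case: x => c a; exact: cvg_snd.
exact: (cvg_comp _ _ H (@set_val_continuous _ _ x.2)).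
Qed.

Lemma rep00_near_torus x : rep (set_val x.2) 0 0 != 0 ->
  \forall y \near x, rep (set_val y.2) 0 0 != 0.
Proof. by move=> /rep00_near; exact: cvg_torus_val. Qed.

Lemma open_sheet b : open (sheet b).
Proof.
rewrite openE => x [x0 sx].
have H : (-1) ^+ b * slope (set_val y.2) @[y --> x] -->
    (-1) ^+ b * slope (set_val x.2).
  apply: cvgM; first exact: cvg_cst.
  exact: (@cvg_slope _ _ _ _ (nbhs_filter x) x0 (@cvg_torus_val x)).
have pos := @cvgr_gt _ _ (nbhs x) _ _ _ H _ sx.
exact: (filterI (rep00_near_torus x0) (pos _)).
Qed.

Lemma rep00_orbit_map x :
  (rep (orbit_map x) 0 0 != 0) = (rep (set_val x.2) 0 0 != 0).
Proof.
case: x => c a; have aT : torus R n (set_val a) by exact: set_valP.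
rewrite /orbit_map /=; have [t ->] := torusP aT.
have E := act_torus t (set_valP (repr (c : ker_quot (@left_coset R n)))).
apply: etrans (congr1 (fun l => rep l 0 0 != 0) E) _.
apply: etrans (rep00_torus t (coset_col_sphere c)) _.
exact: esym (rep00_torus t (@sphere_e1 R n)).
Qed.

Lemma aff_orbit_map x : rep (set_val x.2) 0 0 != 0 ->
  aff (orbit_map x) - e0 = (slope (set_val x.2))%:C *: coset_col x.1.
Proof.
move=> x0; rewrite (orbit_map_slope x0) aff_affine ?[_ - e0]addrC ?addKr//.
by case: (coset_col_sphere x.1) => c0 _; rewrite mxE c0 mulr0.
Qed.

Lemma cell_orbit_map x : cell (orbit_map x) <->
  rep (set_val x.2) 0 0 != 0 /\ slope (set_val x.2) != 0.
Proof.
have u0 : coset_col x.1 != 0.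
  apply/eqP => cz; have [_] := coset_col_sphere x.1; rewrite cz /sqnorm big1.
    by move/eqP; rewrite eq_sym oner_eq0.
  by move=> i _; rewrite mxE normr0 expr0n.
split=> [/cellP[]|[a0 s0]].
  rewrite rep00_orbit_map => a0; rewrite (aff_orbit_map a0) scaler_eq0 negb_or.
  by rewrite fmorph_eq0 => /andP[].
apply/cellP; rewrite rep00_orbit_map; split; first exact: a0.
by rewrite (aff_orbit_map a0) scaler_eq0 negb_or fmorph_eq0 s0.
Qed.

Lemma preimage_cell : orbit_map @^-1` (@cell R n) = sheet false `|` sheet true.
Proof.
apply/seteqP; split=> x.
  move=> /cell_orbit_map[a0 s0]; move: s0; rewrite neq_lt => /orP[s0|s0].
    by right; split; rewrite ?expr1 ?mulN1r ?oppr_gt0.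
  by left; split; rewrite ?expr0 ?mul1r.
move=> [[a0 s0]|[a0 s0]]; apply/cell_orbit_map; split; try exact: a0.
  by move: s0; rewrite expr0 mul1r => s0; rewrite gt_eqF.
by move: s0; rewrite expr1 mulN1r oppr_gt0 => s0; rewrite lt_eqF.
Qed.

Lemma disjoint_sheets : sheet false `&` sheet true = set0.
Proof.
apply/seteqP; split=> // x [[_ s0] [_ s1]].
move: s0 s1; rewrite expr0 mul1r expr1 mulN1r oppr_gt0 => s0 s1.
by have := lt_trans s0 s1; rewrite ltxx.
Qed.

(** A point with affine part [w] is [r u] for [r = |w|], [u = w / |w|] and for
   their opposites. *)
Definition sheet_inv b l : K0modM R n * set_type (torus R n) :=
  let w := aff l - e0 in
  (coset_of_col (((-1) ^+ b / len w)%:C *: w),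
   torus_point n ((-1) ^+ b * len w)).

Lemma affine_part00 l : rep l 0 0 != 0 -> (aff l - e0) 0 0 = 0.
Proof. by move=> /aff00 a0; rewrite mxE a0 !mxE subrr. Qed.

Lemma sphere_affine_part b l : cell l ->
  sphere (((-1) ^+ b / len (aff l - e0))%:C *: (aff l - e0)).
Proof.
move=> /cellP[l0 w0]; split; first by rewrite mxE affine_part00// mulr0.
rewrite rmorphM rmorph_sign -scalerA sqnormZ normr_sign expr1n mul1r.
exact: sqnorm_normalize.
Qed.

Lemma sheet_invK b l : cell l -> orbit_map (sheet_inv b l) = l.
Proof.
move=> lc; have [l0 w0] := (cellP l).1 lc; have lw := len_gt0 w0.
have r0 : rep (set_val (sheet_inv b l).2) 0 0 != 0.
  by rewrite set_val_elt; apply: rep00_affine; rewrite !mxE mulr0.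
rewrite (orbit_map_slope r0) slope_torus_pointE coset_of_colK; last first.
  exact: sphere_affine_part.
rewrite scalerA -rmorphM mulrACA -expr2 sqrr_sign mul1r divff ?gt_eqF//.
by rewrite rmorph1 scale1r addrC subrK point_of_aff.
Qed.

Lemma orbit_mapK b x : sheet b x -> sheet_inv b (orbit_map x) = x.
Proof.
case: x => c a [/= a0 s0].
rewrite /sheet_inv (aff_orbit_map (x := (c, a)) a0) /=.
rewrite len_scale; last exact: coset_col_sphere.
set s := slope (set_val a) in s0 *.
have sn : `|s| = (-1) ^+ b * s.
  by rewrite -(gtr0_norm s0) normrM normr_sign mul1r.
have sn0 : s != 0 by apply: contraTneq s0 => ->; rewrite mulr0 ltxx.
have r1 : (-1) ^+ b / `|s| * s = 1.
  rewrite sn invfM mulrA divff ?signr_eq0// mul1r.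
  exact: mulVf.
have r2 : (-1) ^+ b * `|s| = s by rewrite sn mulrA -expr2 sqrr_sign mul1r.
congr pair.
  apply: coset_col_inj; rewrite scalerA -rmorphM r1 rmorph1 scale1r.
  exact/coset_of_colK/coset_col_sphere.
rewrite r2 /torus_point; apply: elt_eq.
exact: (torus_slope (set_valP a) a0).
Qed.

Lemma sheet_inv_in b l : cell l -> sheet b (sheet_inv b l).
Proof.
move=> lc; have [l0 w0] := (cellP l).1 lc; have lw := len_gt0 w0.
split; last by rewrite slope_torus_pointE mulrA -expr2 sqrr_sign mul1r.
by rewrite set_val_elt; apply: rep00_affine; rewrite !mxE mulr0.
Qed.

(** A product of quotient maps need not be a quotient map, so continuity cannot
   be tested on [K_0] times the torus.  It is read off [orbit_map_slope], all
   the terms of which are continuous on the product. *)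
Lemma orbit_map_cvg x : rep (set_val x.2) 0 0 != 0 ->
  orbit_map y @[y --> x] --> orbit_map x.
Proof.
move=> x0; rewrite (orbit_map_slope x0).
pose phi (y : K0modM R n * set_type (torus R n)) : CP R n :=
  point_of (e0 + (slope (set_val y.2))%:C *: coset_col y.1).
have fst_cvg : y.1 @[y --> x] --> x.1.
  by case: x {x0} => c a; exact: cvg_fst.
have H : phi y @[y --> x] --> phi x.
  apply: point_of_cvg; last first.
    by apply: affine_neq0; case: (coset_col_sphere x.1) => c0 _;
      rewrite mxE c0 mulr0.
  have cs := @cvg_slope _ _ _ _ (nbhs_filter x) x0 (@cvg_torus_val x).
  have cc : coset_col y.1 @[y --> x] --> coset_col x.1.
    exact: (cvg_comp _ _ fst_cvg (@coset_col_continuous _ _ x.1)).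
  have csC : (slope (set_val y.2))%:C @[y --> x] --> (slope (set_val x.2))%:C.
    exact: (cvg_comp _ _ cs (@real_complex_continuous _ _)).
  by apply: cvgD; [exact: cvg_cst|exact: cvgZ csC cc].
apply: (cvg_trans _ H); apply: near_eq_cvg.
apply: filterS (rep00_near_torus x0) => y y0.
exact: esym (orbit_map_slope y0).
Qed.

Lemma cvg_torus_point (T : Type) (F : set_system T) (r : T -> R) (r0 : R) :
  Filter F -> r x @[x --> F] --> r0 ->
  torus_point n (r x) @[x --> F] --> torus_point n r0.
Proof.
move=> FF rr; apply: cvg_set_type; rewrite set_val_elt.
have -> : (fun t : T => set_val (torus_point n (r t))) =
    (fun t : T => point_of (e0 + (r t)%:C *: e1)).
  by apply/funext => t; rewrite set_val_elt.
apply: point_of_cvg; last by apply: affine_neq0; rewrite !mxE mulr0.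
apply: cvgD; first exact: cvg_cst.
apply: cvgZr_tmp; exact: (cvg_comp _ _ rr (@real_complex_continuous _ _)).
Qed.

Lemma sheet_inv_cvg b l : cell l ->
  sheet_inv b r @[r --> l] --> sheet_inv b l.
Proof.
move=> lc; have [l0 w0] := (cellP l).1 lc; have lw := len_gt0 w0.
have near_cell : \forall r \near l, cell r.
  by apply: open_nbhs_nbhs; split=> //; exact: open_cell.
have sph := sphere_affine_part b lc.
have near_sph := @filterS _ _ (nbhs_filter l) _ _
  (fun r => @sphere_affine_part b r) near_cell.
have cw : aff r - e0 @[r --> l] --> aff l - e0.
  exact: (cvgB (aff_cvg l0) (cvg_cst e0)).
have clen := @cvg_len _ _ _ _ _ _ (nbhs_filter l) cw.
have cc : coset_of_col (((-1) ^+ b / len (aff r - e0))%:C *: (aff r - e0))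
    @[r --> l] --> (sheet_inv b l).1.
  apply: (@coset_of_col_cvg _ _ _ (nbhs l) _ _ (nbhs_filter l) _ sph near_sph).
  apply: (cvgZ _ cw).
  have H : (-1) ^+ b / len (aff r - e0) @[r --> l] -->
      (-1) ^+ b / len (aff l - e0).
    exact: (cvgMl_tmp (cvgV (lt0r_neq0 lw) clen)).
  exact: (cvg_comp _ _ H (@real_complex_continuous _ _)).
have ct : torus_point n ((-1) ^+ b * len (aff r - e0))
    @[r --> l] --> (sheet_inv b l).2.
  exact: (@cvg_torus_point _ _ _ _ (nbhs_filter l) (cvgMl_tmp clen)).
exact: (cvg_pair cc ct).
Qed.

Lemma homeo_sheet b : homeo_between orbit_map (sheet b) (@cell R n).
Proof.
exists (sheet_inv b); split.
- split=> [_ [x xs <-]|_ [l lc <-]]; last exact: sheet_inv_in.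
  by suff : (orbit_map @^-1` (@cell R n)) x by []; rewrite preimage_cell;
    case: b xs; [right|left].
- split=> [x /set_mem|l /set_mem]; first exact: orbit_mapK.
  exact: sheet_invK.
- rewrite continuous_open_subspace; last exact: open_sheet.
  by move=> x /set_mem[x0 _]; exact: orbit_map_cvg.
- rewrite continuous_open_subspace; last exact: open_cell.
  by move=> l /set_mem; exact: sheet_inv_cvg.
Qed.

(** Each sheet is homeomorphic to the whole of [cell], so [cell] is itself an
   evenly covered neighbourhood of its points. *)
Lemma orbit_map_double_covering : double_covering_over orbit_map (@cell R n).
Proof.
move=> l lc; exists (@cell R n), (sheet false), (sheet true); split.
- by split=> //; exact: open_cell.
- by split; exact: open_sheet.
- by split; [exact: preimage_cell|exact: disjoint_sheets].
- by split; exact: homeo_sheet.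
Qed.

End orbit_map.

(** * The action in charts *)

Section action_smooth.
Context (R : realType) (n : nat).
Local Notation C := R[i].

Lemma open_neq0C (V : normedModType R) (F : V -> C) :
  CinftyC setT F -> open [set x | F x != 0].
Proof.
move=> [rF iF].
have -> : [set x | F x != 0] = (fun x => complex.Re (F x)) @^-1` [set y : R |
  y != 0]
    `|` (fun x => complex.Im (F x)) @^-1` [set y : R | y != 0].
  apply/seteqP; split=> x /=; rewrite eq_complex /= negb_and.
    by move=> /orP[]; [left|right].
  by move=> [->|->]; rewrite ?orbT.
apply: openU; apply: open_comp; try exact: open_neq.
  by move=> x _; apply: (Ck_continuous (rF 0%N)).
by move=> x _; apply: (Ck_continuous (iF 0%N)).
Qed.

(** Homogeneous coordinates for the affine chart [z_i = 1]. *)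
Definition chart_vec (i : 'I_n.+2) (p : 'M[R]_(n.+1, 1) * 'M[R]_(n.+1, 1)) :
    'cV[C]_n.+2 :=
  \col_k if unlift i k is Some j then unrealify p j 0 else 1.

Lemma chart_vecK (i : 'I_n.+2) (v : 'cV[C]_n.+2) : v i 0 = 1 ->
  chart_vec i (realify (row' i v)) = v.
Proof.
move=> vi; apply/matrixP => k j; rewrite ord1 mxE realifyK.
by case: unliftP => [j' ->|->]; rewrite ?mxE.
Qed.

Lemma CinftyM_chart_vec (V : normedModType R) (U : set V) (i : 'I_n.+2)
    (f : V -> ('M[R]_(n.+1, 1) * 'M[R]_(n.+1, 1))%type) :
  open U -> cont_linear f -> CinftyM U (fun x => chart_vec i (f x)).
Proof.
move=> oU lf k j; under eq_fun do rewrite mxE.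
case: (unlift i k) => [j'|]; last exact: CinftyC_cst.
exact: CinftyM_unrealify.
Qed.

Lemma nonzero_entry (v : 'cV[C]_n.+2) : v != 0 -> exists i, v i 0 != 0.
Proof.
move=> v0; apply: contrapT => nv; move/eqP: v0; apply.
apply/matrixP => i j; rewrite ord1 [RHS]mxE; apply: contrapT => /eqP vi.
by apply: nv; exists i.
Qed.

(** From the chart [z_i = 1] to the chart [z_j = 1] the action multiplies
   homogeneous coordinates by a matrix and divides them by the [j]-th one. *)
Lemma action_smooth : smooth (fun x :
  set_type (K0 R n) * set_type (torus R n) =>
  act (set_val x.1) (set_val x.2) : CP R n).
Proof.
pose X := prod_charted (subset_charted (K0 R n)) (subset_charted (torus R n)).
move=> x.
have [i i0] := nonzero_entry (rep_neq0 (set_val x.2)).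
pose G (p : chart_model X) : 'cV[C]_n.+2 := unrealify p.1 *m chart_vec i p.2.
have CG (U : set (chart_model X)) : open U -> CinftyM U G.
  move=> oU; have l := @cont_linear_id _ (chart_model X).
  apply: CinftyM_mul => //.
    by apply: CinftyM_unrealify => //; exact: (cont_linear_fst l).
  by apply: CinftyM_chart_vec => //; exact: (cont_linear_snd l).
have GE (y : X) : rep (set_val y.2) i 0 != 0 ->
    G (@chart_coord R X (tt, i) y) != 0 /\
    act (set_val y.1) (set_val y.2) = point_of (G (@chart_coord R X (tt, i) y)).
  move=> yi; pose v := (rep (set_val y.2) i 0)^-1 *: rep (set_val y.2).
  have v0 : v != 0 by rewrite scaler_eq0 negb_or invr_eq0 yi rep_neq0.
  have -> : G (@chart_coord R X (tt, i) y) = set_val y.1 *m v.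
    by rewrite /G /= realifyK chart_vecK// mxE mulVf.
  split.
    have uk := K0_unitary (set_valP y.1).
    apply: contraNneq v0 => kv.
    by rewrite -(mul1mx v) -(unitary_adj_mul uk) -mulmxA kv mulmx0.
  have vi0 : (rep (set_val y.2) i 0)^-1 != 0 by rewrite invr_eq0.
  by rewrite /v -scalemxAr (point_of_scale _ vi0).
have [G0 _] := GE x i0.
have [j j0] := nonzero_entry G0.
pose U := [set p : chart_model X | G p j 0 != 0].
have oU : open U by apply: open_neq0C; apply: CG; exact: openT.
exists (tt, i), j, U, (fun p => realify (row' j ((G p j 0)^-1 *: G p))).
split=> //.
- apply: Cinfty_realify => //.
  apply: (@CinftyM_row' _ _ U n.+2 1 j).
  apply: CinftyM_scale => //; last exact: CG.
  by apply: CinftyC_inv => //; exact: CG.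
- move=> y [_ yi] Uy; have [Gy0 ->] := GE y yi; split.
    by rewrite /= rep_entry.
  by rewrite /= normalize_rep.
Qed.

End action_smooth.

(* N = n.+1; part c) is about N >= 2. *)
Theorem proposition1 (R : realType) (n : nat) :
  (* a) *)
  ((forall g, SU R n.+2 g ->
      exists (k1 k2 : 'M[complex R]_n.+2) (theta : R),
        [/\ K0 R n k1, K0 R n k2 & g = k1 *m exp_gen n theta *m k2]) /\
   smooth_surjection
     (fun x : set_type (K0 R n) * set_type (exp_a R n) * set_type (K0 R n) =>
        set_val x.1.1 *m set_val x.1.2 *m set_val x.2)
     (SU R n.+2)) /\
  (* b): K_0 -> K_0 / M is a surjective submersion, so that f is smooth iff
     its composite with K_0 x A -> K_0 / M x A is *)
  (exists f : K0modM R n * set_type (torus R n) -> CP R n,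
     [/\ (forall (k : set_type (K0 R n)) (a : set_type (torus R n)),
            f (toK0modM k, a) = act (set_val k) (set_val a)),
         smooth (fun x : set_type (K0 R n) * set_type (torus R n) =>
                   f (toK0modM x.1, x.2)),
         range f = [set: CP R n] &
         double_covering_over f (~` ([set l0 R n] `|` polar_l0 R n))]) /\
  (* c) *)
  ((0 < n)%N ->
   smooth_surjection
     (fun x : set_type (SU R n.+1) * set_type (circle R) *
              set_type (SO2 R) * set_type (SU R n.+1) =>
        lower_block (set_val x.1.1.1) *m
        upper_block n (delta (set_val x.1.1.2)) *m
        upper_block n (set_val x.1.2) *m
        upper_block n (delta (set_val x.1.1.2)) *m
        lower_block (set_val x.2))
     (SU R n.+2)).
Proof.
split; first by split; [exact: KAK|exact: KAK_smooth].
split; last exact: delta_param_smooth.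
exists (@orbit_map R n); split.
- exact: orbit_map_class.
- have -> : (fun x : set_type (K0 R n) * set_type (torus R n) =>
      orbit_map (toK0modM x.1, x.2)) =
    (fun x => act (set_val x.1) (set_val x.2)).
    by apply/funext => x; exact: orbit_map_class.
  exact: action_smooth.
- by apply/seteqP; split=> // l _; have [x <-] := orbit_map_surj l; exists x.
- exact: orbit_map_double_covering.
Qed.
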